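(* $\mathcal{L}_p(\mathrm{Ext})=\left(2^{\mathfrak{c}}\right)^+$. In particular, each of the classes $\mathrm{Ext}$, $\mathrm{AC}$, $\mathrm{Conn}$, $\mathrm{D}$, $\mathrm{SCIVP}$, $\mathrm{CIVP}$, $\mathrm{PR}$, $\mathrm{WCIVP}$, and $\mathrm{PC}$ of functions from $\mathbb{R}$ to $\mathbb{R}$ is $2^{\mathfrak{c}}$-spaceable with respect to the topology of pointwise convergence.
   Context: $\mathfrak{c}=|\mathbb{R}|$ and $\kappa^+$ is the cardinal successor of $\kappa$. $\mathbb{R}^{\mathbb{R}}$ is the real vector space of all functions from $\mathbb{R}$ to $\mathbb{R}$, and $\tau_p$ is the topology of pointwise convergence on it. For $M\subset\mathbb{R}^{\mathbb{R}}$, $M$ is $\mu$-spaceable with respect to $\tau_p$ if there is a $\tau_p$-closed vector subspace $V\subset M\cup\{0\}$ of dimension $\mu$; and $\mathcal{L}_p(M)=\min\{\kappa\colon M\cup\{0\}\text{ contains no } \tau_p\text{-closed vector subspace of dimension }\kappa\}$ ($\kappa$ ranging over cardinals). A function is identified with its graph. For a topological space $X$ (here $X=\mathbb{R}$ or $X=\mathbb{R}\times[0,1]$), $f\colon X\to\mathbb{R}$ is a connectivity function if the graph of $f\restriction Z$ is connected in $Z\times\mathbb{R}$ for every connected $Z\subset X$. Classes of functions $f\colon\mathbb{R}\to\mathbb{R}$: - $\mathrm{D}$ (Darboux): $f[K]$ is connected for every connected $K\subset\mathbb{R}$. - $\mathrm{AC}$ (almost continuous): each open subset of $\mathbb{R}\times\mathbb{R}$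 containing the graph of $f$ contains also the graph of a continuous function from $\mathbb{R}$ to $\mathbb{R}$. - $\mathrm{Conn}$: the connectivity functions. - $\mathrm{Ext}$ (extendable): there is a connectivity function $F\colon\mathbb{R}\times[0,1]\to\mathbb{R}$ with $f(x)=F(x,0)$ for every $x\in\mathbb{R}$. - $\mathrm{PC}$ (peripherally continuous): for every $x$ and all open sets $U\ni x$ and $V\ni f(x)$ there is an open $W\subset U$ with $x\in W$ and $f[\mathrm{bd}(W)]\subset V$, where $\mathrm{bd}$ denotes boundary. In the following, a perfect set is a nonempty closed set without isolated points, and a set is between $a$ and $b$ if it is contained in the open interval with endpoints $a$ and $b$. - $\mathrm{CIVP}$: for every $x,y\in\mathbb{R}$ and each perfect set $K$ between $f(x)$ and $f(y)$ there is a perfect set $C$ between $x$ and $y$ with $f[C]\subset K$. - $\mathrm{SCIVP}$: for every $x,y\in\mathbb{R}$ and each perfect set $K$ between $f(x)$ and $f(y)$ there is a perfect set $C$ between $x$ and $y$ with $f[C]\subset K$ and $f\restriction C$ continuous. - $\mathrm{WCIVP}$: for every $x,y\in\mathbb{R}$ with $f(x)<f(y)$ there is a perfect set $C$ between $x$ and $y$ with $f[C]\subset(f(x),f(y))$. - $\mathrm{PR}$ (perfect roads): for every $x\in\mathbb{R}$ there is a perfect set $P\subset\mathbb{R}$ having $x$ as a bilateral (two-sided) limit point for which $f\restriction P$ is continuous at $x$.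
   Formalization: L_p(M) is taken as the least κ such that M∪{0} contains no τ_p-closed subspace of dimension at least κ (not exactly κ): closed subspaces of R^R have finite dimension or dimension at least c, so with ''dimension κ'' L_p(M) would never exceed ℵ_0. *)

(* Defs.v *)
From mathcomp Require Import all_boot all_order all_algebra.
From mathcomp Require Import all_classical all_reals all_analysis.

Set Implicit Arguments.
Unset Strict Implicit.
Unset Printing Implicit Defensive.

Import Order.TTheory GRing.Theory Num.Theory numFieldNormedType.Exports.

Local Open Scope classical_set_scope.
Local Open Scope ring_scope.
Local Open Scope card_scope.

(* Cardinals are represented by arbitrary sets, up to #=. *)

Definition card_lt (T U : Type) (A : set T) (B : set U) : Prop :=
  A #<= B /\ ~ (B #<= A).

Definition is_card_succ (T U : Type) (A : set T) (B : set U) : Prop :=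
  card_lt A B /\ forall (W : Type) (C : set W), card_lt A C -> B #<= C.

Definition is_vector_subspace (R : realType) (E : lmodType R) (V : set E) :
    Prop :=
  GRing.submod_closed (mem V).

Definition lin_indep (R : realType) (E : lmodType R) (B : set E) : Prop :=
  forall (s : seq E) (c : E -> R), uniq s -> (forall v, v \in s -> B v) ->
    \sum_(v <- s) c v *: v = 0 -> forall v, v \in s -> c v = 0.

Definition lin_span (R : realType) (E : lmodType R) (B : set E) : set E :=
  [set u | exists (s : seq E) (c : E -> R),
     (forall v, v \in s -> B v) /\ u = \sum_(v <- s) c v *: v].

Definition is_hamel_basis (R : realType) (E : lmodType R) (V B : set E) :
    Prop :=
  lin_indep B /\ lin_span B = V.

Definition has_dim (R : realType) (E : lmodType R) (V : set E)
    (T : Type) (K : set T) : Prop :=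
  exists2 B : set E, is_hamel_basis V B & B #= K.

Definition has_dim_ge (R : realType) (E : lmodType R) (V : set E)
    (T : Type) (K : set T) : Prop :=
  exists2 B : set E, is_hamel_basis V B & K #<= B.

Definition closed_subspace_in (R : realType) (M V : set (R -> R)) : Prop :=
  [/\ is_vector_subspace V,
      closed (V : set {ptws R -> R}) &
      V `<=` M `|` [set 0]].

Definition spaceable_p (R : realType) (M : set (R -> R))
    (T : Type) (K : set T) : Prop :=
  exists2 V : set (R -> R), closed_subspace_in M V & has_dim V K.

(* [is_Lp M K] means that K represents the cardinal
     L_p(M) = min {k | M u {0} contains no closed subspace of dimension k},
   with "of dimension k" understood as "of dimension at least k".  For arbitrary
   subspaces the two readings agree, since a space of dimension at least k has
   subspaces of dimension k.  For closed ones they do not: a closed subspace of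
   R^R is isomorphic to the algebraic dual of a quotient of the space of
   finitely supported functions, so its dimension is finite or at least the
   continuum.  With "exactly k", L_p(M) would thus never exceed aleph_0. *)
Definition is_Lp (R : realType) (M : set (R -> R)) (T : Type) (K : set T) :
    Prop :=
  let no_subspace (U : Type) (L : set U) : Prop :=
    ~ exists2 V : set (R -> R), closed_subspace_in M V & has_dim_ge V L in
  no_subspace T K /\
  forall (U : Type) (L : set U), no_subspace U L -> K #<= L.

Definition graph_on (X Y : Type) (Z : set X) (f : X -> Y) : set (X * Y) :=
  [set (z, f z) | z in Z].

(* A connectivity function on the subspace A of X; only the restriction of f
   to A matters. *)
Definition connectivity_on (R : realType) (X : topologicalType) (A : set X)
    (f : X -> R) : Prop :=
  forall Z : set X, Z `<=` A -> connected Z -> connected (graph_on Z f).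

Definition boundary (X : topologicalType) (W : set X) : set X :=
  closure W `\` W°.

(* [perfect_set] allows the empty set. *)
Definition perfect (R : realType) (P : set R) : Prop :=
  perfect_set P /\ P !=set0.

Definition between (R : realType) (a b : R) : set R :=
  `]Num.min a b, Num.max a b[.

Section DarbouxLike.
Variable R : realType.

Definition Darboux : set (R -> R) :=
  [set f : R -> R | forall K : set R, connected K -> connected (f @` K)].

Definition AlmostContinuous : set (R -> R) :=
  [set f : R -> R | forall G : set (R * R), open G -> graph_on setT f `<=` G ->
     exists2 g : R -> R, continuous g & graph_on setT g `<=` G].

Definition Connectivity : set (R -> R) :=
  [set f : R -> R | connectivity_on setT f].

Definition Extendable : set (R -> R) :=
  [set f : R -> R | exists2 F : R * R -> R,
     connectivity_on [set p : R * R | 0 <= p.2 <= 1] F &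
     forall x, f x = F (x, 0)].

Definition PeripherallyContinuous : set (R -> R) :=
  [set f : R -> R | forall (x : R) (U V : set R),
     open U -> U x -> open V -> V (f x) ->
     exists W : set R, [/\ open W, W `<=` U, W x & f @` boundary W `<=` V]].

Definition CIVP : set (R -> R) :=
  [set f : R -> R | forall (x y : R) (K : set R),
     perfect K -> K `<=` between (f x) (f y) ->
     exists C : set R, [/\ perfect C, C `<=` between x y & f @` C `<=` K]].

Definition SCIVP : set (R -> R) :=
  [set f : R -> R | forall (x y : R) (K : set R),
     perfect K -> K `<=` between (f x) (f y) ->
     exists C : set R, [/\ perfect C, C `<=` between x y, f @` C `<=` K &
       {within C, continuous f}]].

Definition WCIVP : set (R -> R) :=
  [set f : R -> R | forall x y : R, f x < f y ->
     exists C : set R, [/\ perfect C, C `<=` between x y &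
       f @` C `<=` `]f x, f y[]].

Definition PR : set (R -> R) :=
  [set f : R -> R | forall x : R, exists P : set R,
     [/\ perfect P,
         limit_point (P `&` `]-oo, x[) x,
         limit_point (P `&` `]x, +oo[) x &
         f @ within P (nbhs x) --> f x]].

End DarbouxLike.

Arguments Darboux : clear implicits.
Arguments AlmostContinuous : clear implicits.
Arguments Connectivity : clear implicits.
Arguments Extendable : clear implicits.
Arguments PeripherallyContinuous : clear implicits.
Arguments CIVP : clear implicits.
Arguments SCIVP : clear implicits.
Arguments WCIVP : clear implicits.
Arguments PR : clear implicits.

(* Main.v *)
Require Import Defs.
From mathcomp Require Import all_boot all_order all_algebra.
From mathcomp Require Import all_classical all_reals all_analysis.
From mathcomp Require Import ring lra zify.
From mathcomp Require wochoice.
Import Order.TTheory GRing.Theory Num.Theory numFieldNormedType.Exports.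
Local Open Scope classical_set_scope.
Local Open Scope ring_scope.

Set Implicit Arguments.
Unset Strict Implicit.
Unset Printing Implicit Defensive.

(** The proof constructs a linear space of functions, of dimension 2^c and closed
    for pointwise convergence, all of whose nonzero members lie in every class.

    The common tool is a ladder for a function [f]. It consists of grids of the line,
    each refining the previous one, and of continuous functions [v n] such that
    [v n.+1] agrees with [v n] on the grid of level [n], the oscillation of [v n] on
    the boxes (the intervals of the grid) of level [n] tends to 0, and [f x] is a
    cluster value of the sequence [v n x] for every [x].

    A function with a ladder is extendable. Let [F] be [f] on the bottom line, [v n]
    at the height [1/(n+1)], and interpolate in between; [F] is continuous above
    the bottom line. On the boundary of the box of height [1/(n+1)] over a grid
    interval, [F] is equal to [v n], hence nearly constant; and by the cluster
    condition every bottom point has arbitrarily small boxes around it (or, if it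
    is a grid point, on both sides of it) with boundary values close to its own. If the
    graph of [F] over a connected set [Z] were split into two relatively open parts,
    every small box of this kind would have all its boundary points in [Z] of one
    colour. Boxes are nested or do not overlap, so one may repaint the inside of each
    largest one-coloured box with the colour of its boundary. The new colouring
    is locally constant on [Z] itself, and it still has both colours if two points
    are protected in advance ([strip_not_separated]). The largest boxes on which the
    graph of [v n] lies in a given open set yield almost continuity in the same way
    ([almost_continuous_selection]).

    A ladder constrains [f] at few points only. In the basic ladder, [v n.+1] is
    obtained from [v n] by moving it, over the middle part of each box of level [n],
    to a target value, where every rational number is the target of infinitely many
    levels. A point that lies infinitely often in the middle part at levels with any
    given target has every real number as a cluster value, and [f] is arbitrary there
    ([base_ladder]). At the remaining points [f] is a cluster value; a growing
    bound on the admissible targets ensures that there is one ([bv_cluster]). Among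
    these points there are, in every interval and for every real number [y], perfect
    sets of points at which the sequence converges to [y] ([bv_perfect_levels]): every
    level set of [f] contains a perfect set in every interval. This gives the classes
    defined by perfect sets, and peripheral continuity.

    There are c many such ladders with pairwise disjoint sets of constrained points.
    Indices are binary sequences. For two indices, any pair of targets occurs
    together at infinitely many levels at which their grids are shifted against each
    other by half a box, so that each point is in the middle part for one of them
    ([bound_uniq]). The space consists of the functions that are, on the set of the
    index [t], a multiple [a t] of the prescribed function, and 0 elsewhere. If
    [a t] is not 0, then the ladder of [t] multiplied by [a t] is a ladder for the
    function, whatever its values on the other sets are. The space is a copy of the
    space of all families [a], whence its dimension; and as the number of
    all real functions is 2^c, no space of functions can have a larger one. *)

(** * Nested grids *)

(** Number of boxes of level [n] per unit of length. The ratio of consecutive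
    levels is divisible by 4, which makes room for half and quarter moves on the
    grid, and it beats the growth of the slopes in [bv_lip]. *)
Fixpoint Wnat (n : nat) : nat :=
  if n is m.+1 then (Wnat m * (16 * m.+2 ^ 2))%N else 1%N.

Section Grid.
Variable R : realType.
Implicit Types (e x y : R) (n m : nat) (k : int).

Definition W n : R := (Wnat n)%:R.

Lemma Wnat_gt n : (n < Wnat n)%N.
Proof.
elim: n => //= n IH; apply: leq_trans (leq_mul IH (_ : 2 <= _)%N); first by lia.
by rewrite (leq_trans _ (leq_pmulr _ _)) // expn_gt0.
Qed.

Lemma W_gt0 n : 0 < W n.
Proof. by rewrite ltr0n; apply: leq_ltn_trans (Wnat_gt n). Qed.

Lemma W_ge n : n.+1%:R <= W n.
Proof. by rewrite ler_nat Wnat_gt. Qed.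

Lemma WS n : W n.+1 = W n * (16 * n.+2%:R ^+ 2).
Proof. by rewrite /W /= natrM natrM natrX. Qed.

Lemma Wnat_mul n m : (n <= m)%N -> exists2 b : nat, (0 < b)%N & Wnat m = (Wnat n * b)%N.
Proof.
move/subnKC => <-; elim: (m - n)%N => [|d [b b0 IH]].
  by exists 1%N => //; rewrite addn0 muln1.
exists (b * (16 * (n + d).+2 ^ 2))%N; last by rewrite addnS /= IH -mulnA.
by rewrite muln_gt0 b0.
Qed.

(** The coordinate in which the grid of level [n], shifted by [e], is the set
    of the integers. *)
Definition pos e n x : R := (x - e) * W n.

Lemma posB e n x y : pos e n x - pos e n y = (x - y) * W n.
Proof. by rewrite /pos -mulrBl; congr (_ * _); ring. Qed.

Definition grid e n x : Prop := pos e n x \is a Num.int.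

(** The index of the box of level [n] that contains [x]. *)
Definition kap e n x : int := Num.floor (pos e n x).

Definition cbox e n k x : Prop := k%:~R <= pos e n x <= k%:~R + 1.
Definition obox e n k x : Prop := k%:~R < pos e n x < k%:~R + 1.

Lemma kapP e n x : (kap e n x)%:~R <= pos e n x < (kap e n x)%:~R + 1.
Proof. by have := floor_itv (pos e n x); rewrite intrD. Qed.

Lemma kap_eq e n x k : k%:~R <= pos e n x < k%:~R + 1 -> kap e n x = k.
Proof. by move=> h; apply: floor_def; rewrite intrD. Qed.

Lemma cbox_kap e n x : cbox e n (kap e n x) x.
Proof. by rewrite /cbox; have /andP[-> /ltW->] := kapP e n x. Qed.

Lemma obox_cbox e n k x : obox e n k x -> cbox e n k x.
Proof. by move=> /andP[/ltW ? /ltW ?]; apply/andP. Qed.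

Lemma obox_kapE e n k x : obox e n k x -> kap e n x = k.
Proof. by move=> /andP[/ltW h1 h2]; apply: kap_eq; rewrite h1. Qed.

Lemma obox_kap e n x : ~ grid e n x <-> obox e n (kap e n x) x.
Proof.
have /andP[h1 h2] := kapP e n x; split=> [ng|/andP[h3 _]].
  rewrite /obox h2 andbT lt_neqAle h1 andbT; apply/eqP => h.
  by apply: ng; rewrite /grid -h intr_int.
by rewrite /grid intrEfloor => /eqP h; rewrite -h ltxx in h3.
Qed.

Lemma grid_pos e n x : grid e n x -> pos e n x = (kap e n x)%:~R.
Proof. by rewrite /grid intrEfloor => /eqP <-. Qed.

Lemma pos_coarse e n m x : (n <= m)%N ->
  exists2 b : nat, (0 < b)%N & forall x, pos e m x = pos e n x * b%:R.
Proof.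
move=> /Wnat_mul[b b0 h]; exists b => // y.
by rewrite /pos /W h natrM mulrA.
Qed.

Lemma grid_fine e n m x : (n <= m)%N -> grid e n x -> grid e m x.
Proof. by move=> /(pos_coarse e x)[b _ h]; rewrite /grid h => hx; rewrite rpredM ?rpred_nat. Qed.

(** A box of the finer grid lies in a single box of the coarser one, since
    every coarse grid point is a fine grid point. *)
Lemma kap_coarse e n m x : (n <= m)%N -> exists2 b : nat, (0 < b)%N &
  [/\ forall y, pos e m y = pos e n y * b%:R,
      (kap e n x)%:~R * b%:R <= (kap e m x)%:~R :> R &
      (kap e m x)%:~R + 1 <= ((kap e n x)%:~R + 1) * b%:R :> R].
Proof.
move=> /(pos_coarse e x)[b b0 h]; exists b => //.
have /andP[h1 h2] := kapP e n x; have /andP[h3 h4] := kapP e m x.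
have bR : (0 : R) < b%:R by rewrite ltr0n.
rewrite h in h3 h4; split => //.
  rewrite -[b%:R]/((b%:Z)%:~R) -intrM ler_int -ltzD1 -(ltr_int R) intrD intrM.
  by apply: le_lt_trans h4; rewrite ler_pM2r.
rewrite -[b%:R]/((b%:Z)%:~R) -[1]/(1%:~R) -!intrD -intrM ler_int lezD1 -(ltr_int R) intrM intrD.
by apply: le_lt_trans h3 _; rewrite ltr_pM2r.
Qed.

Lemma cbox_coarse e n m x y :
  (n <= m)%N -> cbox e m (kap e m x) y -> cbox e n (kap e n x) y.
Proof.
move=> /(kap_coarse e x)[b b0 [h1 h2 h3]]; rewrite /cbox h1 => /andP[h4 h5].
have bR : (0 : R) < b%:R by rewrite ltr0n.
by rewrite -(ler_pM2r bR) -[X in _ && X](ler_pM2r bR) (le_trans h2 h4) (le_trans h5 h3).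
Qed.

Lemma obox_coarse e n m x y :
  (n <= m)%N -> obox e m (kap e m x) y -> obox e n (kap e n x) y.
Proof.
move=> /(kap_coarse e x)[b b0 [h1 h2 h3]]; rewrite /obox h1 => /andP[h4 h5].
have bR : (0 : R) < b%:R by rewrite ltr0n.
by rewrite -(ltr_pM2r bR) -[X in _ && X](ltr_pM2r bR) (le_lt_trans h2 h4) (lt_le_trans h5 h3).
Qed.

Lemma cbox_dist e n k x y : cbox e n k x -> cbox e n k y -> `|x - y| <= (W n)^-1.
Proof.
move=> /andP[h1 h2] /andP[h3 h4]; rewrite -(ler_pM2r (W_gt0 n)).
rewrite mulVf ?gt_eqF ?W_gt0 // -{1}(ger0_norm (ltW (W_gt0 n))) -normrM.
by rewrite -(posB e) ler_norml; apply/andP; split; lra.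
Qed.

Lemma W_inv_le n : (W n)^-1 <= n.+1%:R^-1.
Proof. by rewrite lef_pV2 ?W_ge ?posrE ?W_gt0. Qed.

Lemma inv_small (d : R) : 0 < d -> exists N, forall n, (N <= n)%N -> n.+1%:R^-1 < d.
Proof.
move=> d0; exists (Num.truncn d^-1) => n Nn.
rewrite -[ltRHS]invrK ltf_pV2 ?posrE ?invr_gt0 ?ltr0n //.
apply: lt_le_trans (truncnS_gt _) _; by rewrite ler_nat.
Qed.

(** Locally only the one or two boxes whose closure contains [x] matter. *)
Lemma near_cbox_all e n x : \forall y \near x, forall k, cbox e n k y -> cbox e n k x.
Proof.
have /andP[h1 h2] := kapP e n x.
pose d := Num.min 1 (if pos e n x \is a Num.int then 1 else
   Num.min (pos e n x - (kap e n x)%:~R) ((kap e n x)%:~R + 1 - pos e n x)).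
have d0 : 0 < d.
  rewrite /d lt_min ltr01 /=; case: ifPn => // /negP/obox_kap/andP[h3 h4].
  by rewrite lt_min !subr_gt0 h3.
have : \forall y \near x, `|x - y| < d / W n.
  by apply/nbhs_ballP; exists (d / W n) => //=; rewrite divr_gt0 ?W_gt0.
apply: filterS => y; rewrite ltr_pdivlMr ?W_gt0 // -{1}(ger0_norm (ltW (W_gt0 n))) -normrM.
rewrite -(posB e) ltr_norml => /andP[h3 h4] k /andP[h5 h6].
have : d <= 1 by rewrite /d ge_min lexx.
rewrite /cbox.
case: (boolP (pos e n x \is a Num.int)) => hx.
  have hp := grid_pos hx.
  move: h3 h4; rewrite hp => h3 h4 d1.
  have : (k < kap e n x + 1) by rewrite -(ltr_int R) intrD; lra.
  have : (kap e n x < k + 1 + 1) by rewrite -(ltr_int R) !intrD; lra.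
  rewrite !ltzD1 => a b; rewrite -[1]/(1%:~R) -intrD !ler_int b /=; lia.
have : d <= Num.min (pos e n x - (kap e n x)%:~R) ((kap e n x)%:~R + 1 - pos e n x).
  by rewrite /d (negbTE hx) ge_min lexx orbT.
rewrite le_min => /andP[h7 h8] _.
have -> : k = kap e n x.
  apply/le_anti; rewrite -!ltzD1 -!(ltr_int R) !intrD; apply/andP; split; lra.
by rewrite h1 ltW.
Qed.

Lemma near_cbox e n x : \forall y \near x, cbox e n (kap e n y) x.
Proof. by apply: filterS (near_cbox_all e n x) => y; apply; exact: cbox_kap. Qed.

Lemma near_obox e n k x : obox e n k x -> \forall y \near x, obox e n k y.
Proof.
move=> /andP[kx xk].
have cp : pos e n y @[y --> x] --> pos e n x.
  by apply: cvgM; [apply: cvgB; [exact: cvg_id|exact: cvg_cst]|exact: cvg_cst].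
by apply: filterS2 (cvgr_gt _ cp _ kx) (cvgr_lt _ cp _ xk) => y h1 h2; apply/andP.
Qed.

Definition pt e n k : R := e + k%:~R / W n.

Lemma pos_pt e n k : pos e n (pt e n k) = k%:~R.
Proof. by rewrite /pos /pt addrAC subrr add0r mulfVK // gt_eqF ?W_gt0. Qed.

Lemma kap_pt e n k : kap e n (pt e n k) = k.
Proof. by apply: kap_eq; rewrite pos_pt lexx ltrDl ltr01. Qed.

Lemma grid_pt e n k : grid e n (pt e n k).
Proof. by rewrite /grid pos_pt intr_int. Qed.

Lemma pos_inj e n : injective (pos e n).
Proof. by move=> x y /(mulIf (lt0r_neq0 (W_gt0 n)))/addIr. Qed.

Lemma pt_kap e n x : grid e n x -> pt e n (kap e n x) = x.
Proof. by move=> gx; apply: (@pos_inj e n); rewrite pos_pt grid_pos. Qed.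

Lemma kap_coarse_eq e n m x y :
  (n <= m)%N -> kap e m x = kap e m y -> kap e n x = kap e n y.
Proof.
move=> /(kap_coarse e x)[b b0 [hb h1 h2]] E; apply/esym/kap_eq.
have bR : (0 : R) < b%:R by rewrite ltr0n.
have /andP[h3 h4] := kapP e m y; rewrite -E hb in h3 h4.
by rewrite -(ler_pM2r bR) -(ltr_pM2r bR) (le_trans h1 h3) (lt_le_trans h4 h2).
Qed.

End Grid.

(** * Connectedness through locally constant predicates *)

Lemma connected_const (T : topologicalType) (Z : set T) (P : T -> Prop) :
  connected Z ->
  (forall u, Z u -> \forall p \near u, Z p -> (P p <-> P u)) ->
  forall a b, Z a -> Z b -> P a -> P b.
Proof.
move=> cZ locP a b Za Zb Pa.
have /seteqP[_ /(_ b Zb)[]//] : Z `&` P = Z.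
apply: cZ; first by exists a.
- exists (interior (fun u => Z u -> P u)); first exact: open_interior.
  apply/seteqP; split=> u [Zu]; last by move=> /nbhs_singleton /(_ Zu).
  move=> Pu; split=> //; apply: filterS (locP u Zu) => p h Zp.
  by apply/(h Zp).
- exists (~` interior (fun u => Z u -> ~ P u)).
    by apply: open_closedC; exact: open_interior.
  apply/seteqP; split=> u [Zu] => [Pu|nP]; split=> //.
    by move=> /nbhs_singleton /(_ Zu).
  apply: contrapT => nPu; apply: nP.
  by apply: filterS (locP u Zu) => p h Zp /(h Zp).
Qed.

Lemma const_connected (T : topologicalType) (Z : set T) :
  (forall P : T -> Prop,
    (forall u, Z u -> \forall p \near u, Z p -> (P p <-> P u)) ->
    forall a b, Z a -> Z b -> P a -> P b) -> connected Z.
Proof.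
move=> cst B [a Ba] [C oC BC] [D cD BD].
have Za : Z a by rewrite BC in Ba; case: Ba.
apply/seteqP; split=> b; first by rewrite BC => -[].
move=> Zb; apply: (cst B _ a b) => // u Zu.
have [Bu|nBu] := pselect (B u).
  have Cu : C u by rewrite BC in Bu; case: Bu.
  apply: filterS (open_nbhs_nbhs (conj oC Cu)) => p Cp Zp.
  by split=> // _; rewrite BC.
have Du : (~` D) u by move=> Du; apply: nBu; rewrite BD.
apply: filterS (open_nbhs_nbhs (conj (closed_openC cD) Du)) => p Dp Zp.
by split=> //; rewrite BD => -[].
Qed.

(** The graph of [F] over [Z] is connected as soon as every predicate on [Z]
    that is locally constant along the graph is constant. Here the points to be
    compared are close to each other in [Z] and have close values. *)
Lemma graph_const_connected (R : realType) (X : pseudoMetricType R) (Z : set X)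
    (F : X -> R) :
  (forall Q : X -> Prop,
    (forall u, Z u -> exists2 d : R, 0 < d &
       forall p, Z p -> ball u d p -> `|F u - F p| < d -> (Q p <-> Q u)) ->
    forall a b, Z a -> Z b -> Q a -> Q b) -> connected (graph_on Z F).
Proof.
move=> cst; apply: const_connected => P locP _ _ [a Za <-] [b Zb <-] Pa.
apply: (cst (fun u => P (u, F u)) _ a b) => // u Zu.
have : graph_on Z F (u, F u) by exists u.
move=> /locP /nbhs_ballP[d /= d0 h]; exists d => // p Zp up Fup.
by apply: h; [split|exists p].
Qed.

(** * Ladders of continuous functions *)

Section Ladder.
Variable R : realType.
Implicit Types (x y d : R) (n m N : nat) (k : int).

(** The values of [f] are only constrained as cluster values of the sequence
    [v n x]; at the grid points this sequence is eventually constant. *)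
Record ladder (e : R) (v : nat -> R -> R) (f : R -> R) : Prop := Ladder {
  ladder_cont : forall n, continuous (v n);
  ladder_grid : forall n x, grid e n x -> v n.+1 x = v n x;
  ladder_osc : exists A : R, forall n k x y, cbox e n k x -> cbox e n k y ->
    `|v n x - v n y| <= A / n.+1%:R;
  ladder_cluster : forall x d N, 0 < d ->
    exists2 n, (N <= n)%N & `|v n x - f x| < d }.

Variables (e : R) (v : nat -> R -> R) (f : R -> R).
Hypothesis L : ladder e v f.

Lemma ladder_stable n m x : (n <= m)%N -> grid e n x -> v m x = v n x.
Proof.
move=> /subnKC <-; elim: (m - n)%N => [|d IH] gx; first by rewrite addn0.
by rewrite addnS (ladder_grid L) ?IH //; apply: grid_fine gx; rewrite leq_addr.
Qed.

Lemma ladder_on_grid n x : grid e n x -> f x = v n x.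
Proof.
move=> gx; apply/eqP; rewrite eq_sym -subr_eq0 -normr_eq0.
apply: contraT => nz; have d0 : 0 < `|v n x - f x| by rewrite lt_def nz /=.
have [m nm] := ladder_cluster L x n d0.
by rewrite (ladder_stable nm gx) ltxx.
Qed.

(** The oscillation over a box tends to zero with the level, so closeness of
    [v n x] to [f x] controls the whole box of level [n] around [x]. *)
Lemma ladder_box d N x : 0 < d -> exists2 n, (N <= n)%N &
  forall k y, cbox e n k x -> cbox e n k y -> `|v n y - f x| < d.
Proof.
move=> d0; have [A hA] := ladder_osc L.
have [N' hN'] : exists N', forall n, (N' <= n)%N -> A / n.+1%:R < d / 2.
  have [N' h] := @inv_small R (d / 2 / (`|A| + 1)) ltac:(by rewrite !divr_gt0 // ltr_pwDr).
  exists N' => n /h h'; apply: le_lt_trans (_ : (`|A| + 1) * n.+1%:R^-1 < _).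
    by rewrite ler_wpM2r ?invr_ge0 // ler_wpDr ?ler_norm.
  by rewrite mulrC -ltr_pdivlMr // ltr_pwDr.
have [n nN hn] := ladder_cluster L x (maxn N N') (divr_gt0 d0 (ltr0n R 2)).
move: nN; rewrite geq_max => /andP[nN /hN' nN']; exists n => // k y bx byy.
have := hA n k y x byy bx; have := ler_distD (v n x) (v n y) (f x).
by move: (A / _) hn nN' => b h1 h2 h3 h4; lra.
Qed.

(** At a grid point the sequence is eventually equal to [f x], so that all
    boxes of high level can be used, in particular those on both sides. *)
Lemma ladder_box_grid d x n0 : 0 < d -> grid e n0 x -> exists N, forall n k y,
  (N <= n)%N -> cbox e n k x -> cbox e n k y -> `|v n y - f x| < d.
Proof.
move=> d0 gx; have [A hA] := ladder_osc L.
have [N h] := @inv_small R (d / (`|A| + 1)) ltac:(by rewrite !divr_gt0 // ltr_pwDr).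
exists (maxn n0 N) => n k y; rewrite geq_max => /andP[nn0 /h nN] bx byy.
rewrite (ladder_on_grid gx) -(ladder_stable nn0 gx).
apply: le_lt_trans (hA n k y x byy bx) _.
apply: le_lt_trans (_ : (`|A| + 1) * n.+1%:R^-1 < _).
  by rewrite ler_wpM2r ?invr_ge0 // ler_wpDr ?ler_norm.
by rewrite mulrC -ltr_pdivlMr // ltr_pwDr.
Qed.

(** ** The extension to the half-plane *)

Definition clamp (s : R) : R := Num.max 0 (Num.min 1 s).

Lemma clamp0 s : s <= 0 -> clamp s = 0.
Proof. by move=> s0; rewrite /clamp max_l // ge_min s0 orbT. Qed.

Lemma clamp1 s : 1 <= s -> clamp s = 1.
Proof. by move=> s1; rewrite /clamp (min_l s1) max_r. Qed.

Lemma clamp_continuous : continuous clamp.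
Proof.
move=> s; apply: continuous_max; first exact: cvg_cst.
by apply: continuous_min; [exact: cvg_cst|exact: cvg_id].
Qed.

(** Piecewise linear interpolation in [s] between the values [v n x] at the
    integers [n <= N]. *)
Definition interp N x s : R :=
  v 0 x + \sum_(i < N) clamp (s - i%:R) * (v i.+1 x - v i x).

(** The height [y] corresponds to the parameter [1/y - 1], so that the level [n]
    is reached at the height [1/(n+1)]. *)
Definition strip (p : R * R) : R :=
  if p.2 <= 0 then f p.1
  else interp (Num.truncn (p.2^-1 - 1)).+1 p.1 (p.2^-1 - 1).

Lemma interp_widen N N' x s : s <= N%:R -> (N <= N')%N ->
  interp N' x s = interp N x s.
Proof.
move=> sN /subnKC <-; elim: (N' - N)%N => [|d IH]; first by rewrite addn0.
rewrite addnS -IH /interp big_ord_recr /= clamp0 ?mul0r ?addr0 //.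
by rewrite subr_le0 (le_trans sN) // ler_nat leq_addr.
Qed.

Lemma interp_value N n x s : (n <= N)%N -> n%:R <= s ->
  (s = n%:R \/ grid e n x) -> interp N x s = v n x.
Proof.
move=> /subnKC <- ns hs; elim: (N - n)%N => [|d IH].
  rewrite addn0 /interp.
  have -> : \sum_(i < n) clamp (s - i%:R) * (v i.+1 x - v i x) =
            \sum_(i < n) (v i.+1 x - v i x).
    apply: eq_bigr => i _; rewrite clamp1 ?mul1r // lerBrDl natr1.
    by apply: le_trans ns; rewrite ler_nat.
  rewrite -(big_mkord xpredT (fun i => v i.+1 x - v i x)).
  by rewrite telescope_sumr // addrC subrK.
rewrite addnS /interp big_ord_recr /= addrA -/(interp _ _ _) IH.
case: hs => [->|gx].
  by rewrite clamp0 ?mul0r ?addr0 // subr_le0 ler_nat leq_addr.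
by rewrite !(ladder_stable _ gx) ?subrr ?mulr0 ?addr0 // -?addnS ?leq_addr.
Qed.

Lemma strip_interp N x y : 0 < y -> y^-1 - 1 <= N%:R ->
  strip (x, y) = interp N x (y^-1 - 1).
Proof.
move=> y0 yN; rewrite /strip /= leNgt y0 /=.
set M := (Num.truncn _).+1.
have hM : y^-1 - 1 <= M%:R by apply: ltW; exact: truncnS_gt.
have [NM|/ltnW MN] := leqP N M; first by rewrite (interp_widen _ yN).
by rewrite (interp_widen _ hM).
Qed.

Lemma strip_bottom x : strip (x, 0) = f x.
Proof. by rewrite /strip /= lexx. Qed.

(** The top and the two lateral sides of the box of height [1/(n+1)] over a
    grid interval: there the extension is the [n]-th function of the ladder. *)
Definition obox2 n k (p : R * R) : Prop := obox e n k p.1 /\ p.2 < n.+1%:R^-1.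
Definition bd n k (p : R * R) : Prop :=
  [/\ cbox e n k p.1, p.2 <= n.+1%:R^-1 & ~ obox2 n k p].

Lemma cbox_notobox n k x : cbox e n k x -> ~ obox e n k x -> grid e n x.
Proof.
move=> /andP[h1 h2] no; rewrite /grid.
have [e1|n1] := eqVneq (pos e n x) k%:~R; first by rewrite e1 intr_int.
have [e2|n2] := eqVneq (pos e n x) (k%:~R + 1).
  by rewrite e2 -[1]/(1%:~R) -intrD intr_int.
by case: no; apply/andP; rewrite !lt_neqAle h1 h2 n2 eq_sym n1.
Qed.

Lemma le_height n y : 0 < y -> (y <= n.+1%:R^-1) = (n%:R <= y^-1 - 1).
Proof.
move=> y0; rewrite lerBrDr natr1 -[in RHS](invrK n.+1%:R) lef_pV2 //.
by rewrite posrE invr_gt0.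
Qed.

Lemma strip_grid n x y : grid e n x -> 0 <= y <= n.+1%:R^-1 ->
  strip (x, y) = v n x.
Proof.
move=> gx /andP[]; rewrite le_eqVlt => /predU1P[<- _|y0].
  by rewrite strip_bottom (ladder_on_grid gx).
rewrite le_height // => hy.
have [N hN] : exists N : nat, y^-1 - 1 <= N%:R.
  by exists (Num.truncn (y^-1 - 1)).+1; apply: ltW; exact: truncnS_gt.
rewrite (strip_interp x y0 hN); apply: interp_value => //; last by right.
by rewrite -(ler_nat R); lra.
Qed.

(** On a lateral side, which lies over a grid point, the ladder does not change
    any more from level [n] on; on the top side the interpolation parameter is
    exactly [n]. *)
Lemma strip_bd n k p : bd n k p -> 0 <= p.2 -> strip p = v n p.1.
Proof.
case: p => x y [/= bx yh no] y0.
have [h|/cbox_notobox gx] := pselect (obox e n k x); last first.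
  by apply: strip_grid; [exact: gx|rewrite y0].
have -> : y = n.+1%:R^-1.
  by apply/le_anti; rewrite yh /= leNgt; apply/negP => yl; apply: no.
have h0 : 0 < n.+1%:R^-1 :> R by rewrite invr_gt0.
have hn : (n.+1%:R^-1)^-1 - 1 = n%:R :> R by rewrite invrK -natr1 addrK.
rewrite (strip_interp x h0 (N := n)) ?hn //.
by apply: interp_value => //; left.
Qed.

Lemma strip_continuous p : 0 < p.2 -> {for p, continuous strip}.
Proof.
case: p => x y /= y0; pose N := (Num.truncn (y^-1 - 1)).+1.
have cinv : {for (x, y), continuous (fun p : R * R => p.2^-1 - 1)}.
  apply: cvgB; last exact: cvg_cst.
  by apply: cvgV; [rewrite gt_eqF|exact: cvg_snd].
have near1 : \forall p \near (x, y), 0 < p.2.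
  exact: (cvgr_gt y (@cvg_snd _ _ (nbhs x) (nbhs y) _) _ y0).
have near2 : \forall p \near (x, y), p.2^-1 - 1 < N%:R.
  by apply: (cvgr_lt _ cinv); exact: truncnS_gt.
have -> : {for (x, y), continuous strip} =
    (strip p @[p --> (x, y)] --> strip (x, y)) by [].
rewrite (strip_interp x y0 (N := N)); last by apply: ltW; exact: truncnS_gt.
have : interp N p.1 (p.2^-1 - 1) @[p --> (x, y)] --> interp N x (y^-1 - 1).
  have cv i : (v i p.1) @[p --> (x, y)] --> v i x.
    by apply: (@cvg_comp _ _ _ fst (v i)); [exact: cvg_fst|exact: (ladder_cont L)].
  elim: N {near2} => [|N IH].
    have -> : (fun p : R * R => interp 0 p.1 (p.2^-1 - 1)) = (fun p => v 0 p.1).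
      by apply/funext => p; rewrite /interp big_ord0 addr0.
    by rewrite /interp big_ord0 addr0.
  have E x' s : interp N.+1 x' s =
      interp N x' s + clamp (s - N%:R) * (v N.+1 x' - v N x').
    by rewrite /interp big_ord_recr addrA.
  rewrite E; under eq_fun do rewrite E.
  apply: cvgD => //=; apply: cvgM; last by apply: cvgB.
  apply: (@cvg_comp _ _ _ (fun p : R * R => p.2^-1 - 1 - N%:R) clamp).
    by apply: cvgB; [exact: cinv|exact: cvg_cst].
  exact: clamp_continuous.
apply: cvg_trans; apply: near_eq_cvg.
apply: filterS2 near1 near2 => -[x' y'] /= y'0 /ltW y'N.
by rewrite (strip_interp x' y'0 y'N).
Qed.

End Ladder.

(** * A function with a ladder is extendable *)

Section StripConnected.
Variables (R : realType) (e : R) (v : nat -> R -> R) (f : R -> R).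
Hypothesis L : ladder e v f.
Implicit Types (x y d : R) (n m N : nat) (k : int) (u p : R * R).

Local Notation F := (strip v f).
Local Notation h n := (n.+1%:R^-1 : R).

Variables (Z : set (R * R)) (Q : R * R -> Prop) (a0 b0 : R * R).
Hypothesis Zstrip : Z `<=` [set p : R * R | 0 <= p.2 <= 1].
Hypothesis locQ : forall u, Z u -> exists2 d, 0 < d &
  forall p, Z p -> ball u d p -> `|F u - F p| < d -> (Q p <-> Q u).
Hypotheses (Za : Z a0) (Zb : Z b0) (Qa : Q a0) (nQb : ~ Q b0).

(** The box has a colour [c] when the points of [Z] on its boundary do. The two
    marked points must not lie inside a box of the opposite colour; as this only
    excludes boxes that are not small, it does not harm the covering property,
    and it ensures that both colours survive the recolouring below. *)
Definition coloured n k (c : Prop) : Prop :=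
  [/\ forall p, Z p -> bd e n k p -> (Q p <-> c),
      obox2 e n k a0 -> c & obox2 e n k b0 -> ~ c].

Definition inner n u := obox2 e n (kap e n u.1) u.

Definition boxed n u := inner n u /\ exists c, coloured n (kap e n u.1) c.

Definition first_box n u := boxed n u /\ forall m, (m < n)%N -> ~ boxed m u.

(** A new colouring of [Z], constant inside each of the largest coloured boxes;
    points inside no coloured box keep their value of [Q]. *)
Definition colour u : Prop :=
  (exists2 n, first_box n u & coloured n (kap e n u.1) True) \/
  ((forall n, ~ boxed n u) /\ Q u).

Lemma Z_ge0 p : Z p -> 0 <= p.2.
Proof. by move=> /Zstrip/andP[]. Qed.

Lemma h_gt0 n : 0 < h n.
Proof. by rewrite invr_gt0. Qed.

Lemma h_le n m : (n <= m)%N -> h m <= h n.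
Proof. by move=> nm; rewrite lef_pV2 ?posrE ?ltr0n // ler_nat. Qed.

Lemma first_boxP u : (exists n, first_box n u) \/ forall n, ~ boxed n u.
Proof.
have [[n bn]|/forallNP] := pselect (exists n, boxed n u); last by right.
have exb : exists n, `[< boxed n u >] by exists n; apply/asboolP.
have [m /asboolP bm minm] := ex_minnP exb; left; exists m; split=> // j jm bj.
by have /minm := introT (asboolP _) bj; rewrite leqNgt jm.
Qed.

Lemma first_box_uniq n m u : first_box n u -> first_box m u -> n = m.
Proof.
move=> [bn mn] [bm mm]; have [nm|mn'|//] := ltngtP n m.
  by case: (mm n nm).
by case: (mn m mn').
Qed.

Lemma colour_first n u : first_box n u ->
  (colour u <-> coloured n (kap e n u.1) True).
Proof.
move=> fn; split=> [[[m fm]|[/(_ n) []]]|cn]; last by left; exists n.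
  by rewrite (first_box_uniq fm fn).
by case: fn.
Qed.

Lemma colour_none u : (forall n, ~ boxed n u) -> (colour u <-> Q u).
Proof. by move=> nb; split=> [[[m [/nb]]|[]]|] //; right. Qed.

(** A box without boundary points in [Z] may admit both colours; otherwise its
    colour is forced. *)
Lemma coloured_bd n k c p : coloured n k c -> Z p -> bd e n k p ->
  (coloured n k True <-> Q p).
Proof.
move=> [cbd ca cb] Zp bp; split=> [[h _ _]|Qp]; first by apply/(h p Zp bp).
have cT : c by apply/(cbd p Zp bp).
by split=> [q Zq bq|//|/cb //]; rewrite (cbd q Zq bq).
Qed.

Lemma inner_same n m u w : (m <= n)%N -> inner n u ->
  obox2 e n (kap e n u.1) w -> kap e m w.1 = kap e m u.1 /\ inner m w.
Proof.
move=> mn [u1 u2] [w1 w2]; have o := obox_coarse mn w1.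
have E := obox_kapE o; split=> //; split; first by rewrite E.
exact: lt_le_trans w2 (h_le mn).
Qed.

Lemma boxed_same n m u w : (m <= n)%N -> inner n u ->
  obox2 e n (kap e n u.1) w -> (boxed m w <-> boxed m u).
Proof.
move=> mn iu ow; have [E iw] := inner_same mn iu ow.
have [_ iu'] := inner_same mn iu iu.
by rewrite /boxed E; split=> -[_ ?].
Qed.

Lemma near_obox2 n k u : obox2 e n k u -> \forall p \near u, obox2 e n k p.
Proof.
case: u => x y [/= /andP[ku uk] yh].
have near1 : \forall p \near (x, y), obox e n k p.1.
  apply: (@cvg_fst _ _ (nbhs x) (nbhs y) _); apply: near_obox; exact/andP.
have near2 : \forall p \near (x, y), p.2 < h n.
  exact: (cvgr_lt y (@cvg_snd _ _ (nbhs x) (nbhs y) _)).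
by apply: filterS2 near1 near2.
Qed.

Lemma ball_avoid u w : u <> w -> exists2 d : R, 0 < d & ~ ball u d w.
Proof.
case: u w => x y [x' y'] uw; have [xx'|xx'] := eqVneq x x'; last first.
  by exists `|x - x'|; [rewrite normr_gt0 subr_eq0|case=> /=; rewrite /ball /= ltxx].
have [yy'|yy'] := eqVneq y y'; first by case: uw; rewrite xx' yy'.
by exists `|y - y'|; [rewrite normr_gt0 subr_eq0|case=> /=; rewrite /ball /= ltxx].
Qed.

Lemma locQ_avoid u : Z u -> exists2 d, 0 < d & forall p, ball u d p ->
  [/\ Z p -> `|F u - F p| < d -> (Q p <-> Q u), p = a0 -> Q u & p = b0 -> ~ Q u].
Proof.
move=> Zu; have [d d0 hd] := locQ Zu.
have [d' d'0 hd'] : exists2 d', 0 < d' &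
    forall p, ball u d' p -> (p = a0 -> Q u) /\ (p = b0 -> ~ Q u).
  have [Qu|nQu] := pselect (Q u).
    have [|d' d'0 nb] := @ball_avoid u b0; first by move=> E; rewrite E in Qu.
    by exists d' => // p bp; split=> // E; rewrite E in bp.
  have [|d' d'0 nb] := @ball_avoid u a0; first by move=> E; rewrite E in nQu.
  by exists d' => // p bp; split=> // E; rewrite E in bp.
exists (Num.min d d'); first by rewrite lt_min d0.
move=> p bp; have [h1 h2] : ball u d p /\ ball u d' p.
  by split; apply: le_ball bp; rewrite ge_min lexx ?orbT.
by have [? ?] := hd' p h2; split=> // Zp; rewrite lt_min => /andP[? _]; apply: hd.
Qed.

Lemma coloured_small x d n k : 0 < d -> Z (x, 0) -> h n < d -> cbox e n k x ->
  (forall p, ball ((x, 0) : R * R) d p ->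
    [/\ Z p -> `|F (x, 0) - F p| < d -> (Q p <-> Q (x, 0)),
        p = a0 -> Q (x, 0) & p = b0 -> ~ Q (x, 0)]) ->
  (forall y, cbox e n k y -> `|v n y - f x| < d) -> coloured n k (Q (x, 0)).
Proof.
move=> d0 Zx hn bx hd near_f.
have small p : Z p -> cbox e n k p.1 -> p.2 <= h n -> ball ((x, 0) : R * R) d p.
  move=> /Z_ge0 p0 bp ph; split; rewrite /ball /=.
    by apply: le_lt_trans hn; apply: le_trans (cbox_dist bx bp) (W_inv_le _ _).
  by rewrite sub0r normrN ger0_norm // (le_lt_trans ph).
split.
- move=> p Zp bp; have [b1 b2 _] := bp.
  have [h1 _ _] := hd p (small p Zp b1 b2); apply: h1 => //.
  rewrite (strip_bd L bp (Z_ge0 Zp)) strip_bottom distrC; exact: near_f.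
- move=> [w1 /ltW o2].
  by have [_ h1 _] := hd a0 (small a0 Za (obox_cbox w1) o2); apply: h1.
- move=> [w1 /ltW o2].
  by have [_ _ h1] := hd b0 (small b0 Zb (obox_cbox w1) o2); apply: h1.
Qed.

(** The values of the extension on the boundaries of small boxes at a point of
    the bottom line are close to its value at this point, so that [Q] cannot
    change between them. *)
Lemma bottom_boxed x : Z (x, 0) -> (forall n, ~ grid e n x) ->
  exists n, boxed n (x, 0).
Proof.
move=> Zx ng; have [d d0 hd] := locQ_avoid Zx.
have [N hN] := inv_small d0; have [n /hN hn near_f] := ladder_box L N x d0.
exists n; split; first by split; [apply/obox_kap|exact: h_gt0].
exists (Q (x, 0)); apply: (coloured_small d0 Zx hn (cbox_kap _ _ _) hd) => y.
by apply: near_f; exact: cbox_kap.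
Qed.

Lemma bottom_grid_coloured x n0 : Z (x, 0) -> grid e n0 x ->
  exists N, forall n k, (N <= n)%N -> cbox e n k x -> coloured n k (Q (x, 0)).
Proof.
move=> Zx gx; have [d d0 hd] := locQ_avoid Zx.
have [N hN] := inv_small d0; have [N' near_f] := ladder_box_grid L d0 gx.
exists (maxn N N') => n k; rewrite geq_max => /andP[/hN hn N'n] bx.
apply: (coloured_small d0 Zx hn bx hd) => y; exact: near_f.
Qed.

(** Above the bottom line, only finitely many levels reach the height of [u],
    and near [u] their boxes contain [u] in their closure. *)
Lemma near_bd u : 0 < u.2 -> \forall p \near u, forall n, inner n p ->
  cbox e n (kap e n p.1) u.1 /\ u.2 <= h n.
Proof.
case: u => x y /= y0.
have c1 : p.1 @[p --> (x, y)] --> x by exact: cvg_fst.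
have c2 : p.2 @[p --> (x, y)] --> y by exact: cvg_snd.
have [N hN] := @inv_small R (y / 2) ltac:(by rewrite divr_gt0).
have one n : \forall p \near (x, y), inner n p ->
    cbox e n (kap e n p.1) x /\ y <= h n.
  have near1 : \forall p \near (x, y), cbox e n (kap e n p.1) x.
    exact: (c1 _ (near_cbox e n x)).
  have [yh|hy] := leP y (h n).
    by apply: filterS near1 => p bp _; split.
  have near2 : \forall p \near (x, y), h n < p.2 by exact: (cvgr_gt y c2).
  by apply: filterS near2 => p hp [_ /(lt_trans hp)]; rewrite ltxx.
have near2 : \forall p \near (x, y), y / 2 < p.2.
  by apply: (cvgr_gt y c2); rewrite ltr_pdivrMr // ltr_pMr // ltr1n.
have near3 : \forall p \near (x, y), forall i : 'I_N, inner i p ->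
    cbox e i (kap e i p.1) x /\ y <= h i.
  exact: (@filter_forall _ 'I_N (fun i p => inner i p ->
    cbox e i (kap e i p.1) x /\ y <= h i) (nbhs (x, y)) _ (fun i => one i)).
apply: filterS2 near2 near3 => p p2 p3 n ip.
have [nN|/hN hn] := ltnP n N; first exact: (p3 (Ordinal nN)).
by have [_ /(lt_trans p2)/(lt_trans hn)] := ip; rewrite ltxx.
Qed.

Lemma on_bd u n p : Z u -> (forall m, ~ boxed m u) -> boxed n p ->
  cbox e n (kap e n p.1) u.1 -> u.2 <= h n ->
  (coloured n (kap e n p.1) True <-> Q u).
Proof.
move=> Zu nb [ip [c cc]] bu uh; apply: (coloured_bd cc) => //; split=> // ou.
by apply: (nb n); apply/(boxed_same (leqnn n) ip ou); split=> //; exists c.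
Qed.

Lemma colour_loc_up u : Z u -> 0 < u.2 -> (forall n, ~ boxed n u) ->
  \forall p \near u, Z p -> (colour p <-> colour u).
Proof.
move=> Zu u0 nb; have [d d0 hd] := locQ Zu.
have n1 : \forall p \near u, ball u d p by exact: nbhsx_ballx.
have n2 : \forall p \near u, `|F u - F p| < d.
  by have /cvgr_dist_lt := strip_continuous L u0; apply.
apply: filterS3 n1 n2 (near_bd u0) => p b1 b2 b3 Zp.
rewrite (colour_none nb); have [[n fn]|nbp] := first_boxP p.
  rewrite (colour_first fn); have [bn _] := fn.
  by have [? ?] := b3 n bn.1; apply: on_bd.
by rewrite (colour_none nbp); apply: hd.
Qed.

(** A bottom point inside no coloured box is a grid point. Small coloured boxes
    lie on both of its sides, and the vertical segment between them carries a
    single value of the extension. *)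
Lemma colour_loc_bottom x : Z (x, 0) -> (forall n, ~ boxed n (x, 0)) ->
  \forall p \near (x, 0), Z p -> (colour p <-> colour (x, 0)).
Proof.
move=> Zx nb.
have [n0 gx] : exists n, grid e n x.
  apply: contrapT => /forallNP ng.
  by have [n /nb] := bottom_boxed Zx ng.
have [d d0 hd] := locQ Zx; have [N hN] := bottom_grid_coloured Zx gx.
pose n := maxn N n0; have gn : grid e n x by apply: grid_fine gx; exact: leq_maxr.
have E := grid_pos gn; set k := kap e n x in E.
have cn j : cbox e n j x -> coloured n j (Q (x, 0)).
  by apply: hN; exact: leq_maxl.
have c1 : pos e n p.1 @[p --> (x, 0 : R)] --> pos e n x.
  by apply: cvgM; [apply: cvgB; [exact: cvg_fst|exact: cvg_cst]|exact: cvg_cst].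
have c2 : p.2 @[p --> (x, 0)] --> (0 : R) by exact: cvg_snd.
have n1 : \forall p \near (x, 0 : R), k%:~R - 1 < pos e n p.1.
  by apply: (cvgr_gt _ c1); rewrite E ltrBlDr ltrDl.
have n2 : \forall p \near (x, 0 : R), pos e n p.1 < k%:~R + 1.
  by apply: (cvgr_lt _ c1); rewrite E ltrDl.
have n3 : \forall p \near (x, 0 : R), p.2 < h n.
  by apply: (cvgr_lt _ c2); exact: h_gt0.
have n4 : \forall p \near (x, 0 : R), ball ((x, 0) : R * R) d p by exact: nbhsx_ballx.
near=> p => Zp; rewrite (colour_none nb).
have p1 : k%:~R - 1 < pos e n p.1 by near: p.
have p2 : pos e n p.1 < k%:~R + 1 by near: p.
have p3 : p.2 < h n by near: p.
have p4 : ball ((x, 0) : R * R) d p by near: p.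
have [px|px] := eqVneq p.1 x.
  have nbp m : ~ boxed m p.
    move=> [[w1 _] cm]; apply: (nb m); rewrite px in w1 cm.
    by split=> //; split=> //; exact: h_gt0.
  rewrite (colour_none nbp); apply: hd => //.
  rewrite strip_bottom (surjective_pairing p) px (strip_grid L gn).
    by rewrite (ladder_on_grid L gn) subrr normr0.
  by rewrite Z_ge0 // ltW.
(* The point is beside [x], hence inside one of the two adjacent boxes. *)
have [k' bx wk'] : exists2 k', cbox e n k' x & obox e n k' p.1.
  have [lt|gt|eq] := ltrgtP (pos e n p.1) k%:~R.
  - have Ek1 : (k - 1)%:~R = k%:~R - 1 :> R by rewrite intrB.
    exists (k - 1); rewrite /cbox /obox Ek1 subrK; last by rewrite p1 lt.
    by rewrite E lexx andbT gerBl.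
  - exists k; last by rewrite /obox gt p2.
    by rewrite /cbox E lexx lerDl ler01.
  - case/eqP: px; move: eq; rewrite -E /pos => /(mulIf (lt0r_neq0 (W_gt0 R n))).
    by move=> /addIr.
have Ek := obox_kapE wk'.
have bn : boxed n p.
  by split; [split; rewrite ?Ek|exists (Q (x, 0)); rewrite Ek; exact: cn].
have [[m fm]|/(_ n)//] := first_boxP p.
have mn : (m <= n)%N by rewrite leqNgt; apply/negP => nm; case: fm => _ /(_ n nm).
rewrite (colour_first fm); apply: on_bd => //; first by case: fm.
  by apply: (cbox_coarse mn); rewrite Ek.
by rewrite ltW // h_gt0.
Unshelve. all: by end_near. Qed.

Lemma colour_loc u : Z u -> \forall p \near u, Z p -> (colour p <-> colour u).
Proof.
move=> Zu; have [[n fn]|nb] := first_boxP u; last first.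
  have := Z_ge0 Zu; rewrite le_eqVlt => /predU1P[E|u0]; last exact: colour_loc_up.
  by move: u E Zu nb => [x y] /= <-; exact: colour_loc_bottom.
have [[iu cu] mu] := fn; apply: filterS (near_obox2 iu) => p op Zp.
have fp : first_box n p.
  split; first by apply/(boxed_same (leqnn n) iu op).
  by move=> m mn; rewrite (boxed_same (ltnW mn) iu op); exact: mu.
rewrite (colour_first fn) (colour_first fp).
by rewrite (inner_same (leqnn n) iu op).1.
Qed.

(** The recolouring is locally constant on [Z] for the topology of the half-plane,
    no longer only along the graph, and it distinguishes the marked points. *)
Lemma strip_not_separated : ~ connected Z.
Proof.
move=> cZ; have ca : colour a0.
  have [[n fn]|nb] := first_boxP a0; last by apply/colour_none.
  apply/(colour_first fn); have [[ia [c [cbd c_a c_b]]] _] := fn.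
  have cT := c_a ia; split=> [p Zp bp|//|/c_b//].
  by rewrite (cbd p Zp bp).
have := connected_const cZ colour_loc Za Zb ca.
have [[n fn]|nb] := first_boxP b0; last by move/(colour_none nb).
by move=> /(colour_first fn)[_ _]; have [[ib _] _] := fn; move=> /(_ ib).
Qed.

End StripConnected.

Lemma ladder_extendable (R : realType) (e : R) (v : nat -> R -> R) (f : R -> R) :
  ladder e v f -> Extendable R f.
Proof.
move=> L; exists (strip v f) => [Z Zs cZ|x]; last by rewrite strip_bottom.
apply: graph_const_connected => Q locQ a b Za Zb Qa; apply: contrapT => nQb.
exact: (strip_not_separated L Zs locQ Za Zb Qa nQb).
Qed.

(** * A function with a ladder is almost continuous *)

Section AlmostContinuity.
Variables (R : realType) (e : R) (v : nat -> R -> R) (f : R -> R).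
Hypothesis L : ladder e v f.
Implicit Types (x y s d : R) (n m N : nat) (k : int).

Variable G : set (R * R).
Hypotheses (oG : open G) (fG : graph_on setT f `<=` G).

Definition good n k := forall y, cbox e n k y -> G (y, v n y).

Lemma good_near x : exists n, \forall y \near x, good n (kap e n y).
Proof.
have : G (x, f x) by apply: fG; exists x.
move=> /(conj oG)/open_nbhs_nbhs/nbhs_ballP[d /= d0 hd].
have [N hN] := inv_small d0.
have goodP n k : (N <= n)%N -> cbox e n k x ->
    (forall y, cbox e n k y -> `|v n y - f x| < d) -> good n k.
  move=> /hN nd bx hv y byy; apply: hd; split; rewrite /ball /=.
    apply: le_lt_trans nd; exact: le_trans (cbox_dist bx byy) (W_inv_le _ _).
  by rewrite distrC hv.
have [[n0 gx]|/forallNP ng] := pselect (exists n, grid e n x).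
  have [N' hv] := ladder_box_grid L d0 gx; exists (maxn N N').
  apply: filterS (near_cbox e (maxn N N') x) => y bx.
  apply: (goodP _ _ _ bx); first exact: leq_maxl.
  by move=> z; apply: (hv _ _ _ _ bx); exact: leq_maxr.
have [n Nn hv] := ladder_box L N x d0; exists n.
apply: filterS (near_obox ((obox_kap e n x).1 (ng n))) => y /obox_kapE ->.
have bx := cbox_kap e n x; apply: goodP => // z; exact: hv.
Qed.

(** The largest good boxes tile the line locally finitely. Following on each of
    them the function of its level is consistent at the common end points, as the
    ladder is stable on grid points. *)
Lemma almost_continuous_selection :
  exists2 g : R -> R, continuous g & graph_on setT g `<=` G.
Proof.
pose P n x := exists2 k, cbox e n k x & good n k.
have [lev hlev] : {lev : R -> nat &
    forall x, P (lev x) x /\ forall m, P m x -> (lev x <= m)%N}.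
  apply: (@choice _ _ (fun x n => P n x /\ forall m, P m x -> (n <= m)%N)) => x.
  have [n /nbhs_singleton gx] := good_near x.
  have exP : exists n, `[< P n x >].
    by exists n; apply/asboolP; exists (kap e n x) => //; exact: cbox_kap.
  have [m /asboolP Pm minm] := ex_minnP exP; exists m; split=> // j /asboolP.
  exact: minm.
exists (fun x => v (lev x) x); last first.
  by move=> _ [x _ <-]; have [[k bx gk] _] := hlev x; exact: gk.
move=> x; have [n gn] := good_near x.
have near1 : \forall y \near x, forall i : 'I_n.+1, forall k, cbox e i k y -> cbox e i k x.
  exact: (@filter_forall _ 'I_n.+1 (fun i y => forall k, cbox e i k y -> cbox e i k x)
    (nbhs x) _ (fun i => near_cbox_all e i x)).
have near2 : \forall y \near x, forall i : 'I_n.+1,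
    ~ grid e i x -> obox e i (kap e i x) y.
  apply: (@filter_forall _ 'I_n.+1 (fun i y => ~ grid e i x -> obox e i (kap e i x) y)
    (nbhs x) _ _) => i.
  have [/obox_kap ng|gx] := pselect (~ grid e i x); last by apply: nearW => y /gx.
  by apply: filterS (near_obox ng).
have agree : \forall y \near x, (lev y <= n)%N /\ v (lev y) x = v (lev x) x.
  apply: filterS3 gn near1 near2 => y gy ny1 ny2.
  have [[k bk gk] miny] := hlev y; have [[k0 bk0 gk0] minx] := hlev x.
  have yn : (lev y <= n)%N by apply: miny; exists (kap e n y) => //; exact: cbox_kap.
  have bx := ny1 (Ordinal (yn : (lev y < n.+1)%N)) k bk.
  have xy : (lev x <= lev y)%N by apply: minx; exists k.
  split=> //; have [gx|ngx] := pselect (grid e (lev x) x).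
    exact: (ladder_stable L xy gx).
  have wx := ny2 (Ordinal (leq_trans xy yn : (lev x < n.+1)%N)) ngx.
  have Ek0 : k0 = kap e (lev x) x.
    have [w0|/(cbox_notobox bk0)//] := pselect (obox e (lev x) k0 x).
    by rewrite (obox_kapE w0).
  have yx : (lev y <= lev x)%N.
    by apply: miny; exists k0 => //; rewrite Ek0; exact: obox_cbox.
  by have -> : lev y = lev x by apply/eqP; rewrite eqn_leq yx xy.
apply/cvgrPdist_lt => d d0.
have near3 : \forall y \near x, forall i : 'I_n.+1, `|v i x - v i y| < d.
  apply: (@filter_forall _ 'I_n.+1 (fun i y => `|v i x - v i y| < d) (nbhs x) _ _) => i.
  by have /cvgrPdist_lt := @ladder_cont _ _ _ _ L i x; apply.
apply: filterS2 agree near3 => y [yn <-] h3.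
exact: (h3 (Ordinal (yn : (lev y < n.+1)%N))).
Qed.

End AlmostContinuity.

Lemma ladder_almost_continuous (R : realType) (e : R) (v : nat -> R -> R)
    (f : R -> R) : ladder e v f -> AlmostContinuous R f.
Proof. by move=> L G oG fG; exact: (almost_continuous_selection L oG fG). Qed.

(** * Consequences for the other classes *)

Lemma extendable_connectivity (R : realType) (f : R -> R) :
  Extendable R f -> Connectivity R f.
Proof.
move=> [F cF Ff] Z _ cZ; pose Z0 := (fun x : R => (x, 0 : R)) @` Z.
have cZ0 : connected Z0.
  apply: connected_continuous_connected => //.
  apply: continuous_subspaceT => x.
  by apply: (@cvg_pair _ _ _ _ (nbhs x) (nbhs 0)); [exact: cvg_id|exact: cvg_cst].
have Z0s : Z0 `<=` [set p : R * R | 0 <= p.2 <= 1].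
  by move=> _ [x Zx <-] /=; rewrite lexx ler01.
have := cF Z0 Z0s cZ0.
have -> : graph_on Z f = (fun q : R * R * R => (q.1.1, q.2)) @` graph_on Z0 F.
  apply/seteqP; split=> [_ [x Zx <-]|_ [_ [_ [x Zx <-] <-] <-]] /=.
    by exists (x, 0, F (x, 0)); [exists (x, 0) => //; exists x|rewrite /= Ff].
  by exists x => //; rewrite Ff.
move=> cG; apply: connected_continuous_connected => //.
apply: continuous_subspaceT => -[[x y] r].
apply: (@cvg_pair _ _ _ _ (nbhs x) (nbhs r)); last exact: cvg_snd.
by apply: (@cvg_comp _ _ _ fst fst _ (nbhs (x, y))); exact: cvg_fst.
Qed.

Lemma connectivity_darboux (R : realType) (f : R -> R) :
  Connectivity R f -> Darboux R f.
Proof.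
move=> cf K cK; have -> : f @` K = snd @` graph_on K f.
  apply/seteqP; split=> [_ [x Kx <-]|_ [_ [x Kx <-] <-]]; last by exists x.
  by exists (x, f x) => //; exists x.
apply: connected_continuous_connected; first exact: cf.
by apply: continuous_subspaceT => q; exact: cvg_snd.
Qed.

(** All the classes defined by means of perfect sets or of peripheral values are
    consequences of this property. *)
Definition perfect_levels (R : realType) (f : R -> R) : Prop :=
  forall y a b : R, a < b ->
    exists C : set R, [/\ perfect C, C `<=` `]a, b[ & forall x, C x -> f x = y].

Section PerfectLevels.
Variables (R : realType) (f : R -> R).
Hypothesis fP : perfect_levels f.
Implicit Types (x y a b : R).

Lemma perfect_level_between x y z : x != y ->
  exists C, [/\ perfect C, C `<=` between x y & forall u, C u -> f u = z].
Proof.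
move=> xy; have mM : Num.min x y < Num.max x y by case: (ltgtP x y) xy.
exact: (fP z mM).
Qed.

Lemma perfect_levels_scivp : SCIVP R f.
Proof.
move=> x y K [_ [z Kz]] Kb.
have [E|xy] := eqVneq x y.
  have := Kb z Kz; rewrite E /between /= min_l // max_l // in_itv /=.
  by move=> /andP[/lt_trans h /h]; rewrite ltxx.
have [C [pC Cxy Cz]] := perfect_level_between z xy; exists C; split=> //.
  by move=> _ [u Cu <-]; rewrite Cz.
have cz : {within C, continuous (fun=> z)}.
  by apply: continuous_subspaceT => u; exact: cvg_cst.
by apply: subspace_eq_continuous cz => u; rewrite inE => Cu; apply/esym/Cz.
Qed.

Lemma perfect_levels_civp : CIVP R f.
Proof.
move=> x y K pK Kb; have [C [pC Cxy CK _]] := perfect_levels_scivp pK Kb.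
by exists C.
Qed.

Lemma perfect_levels_wcivp : WCIVP R f.
Proof.
move=> x y fxy; have xy : x != y by apply: contraTN fxy => /eqP ->; rewrite ltxx.
have [C [pC Cxy Cz]] := perfect_level_between ((f x + f y) / 2) xy.
exists C; split=> // _ [u Cu <-]; have [h1 h2] := midf_lt fxy.
by rewrite /= in_itv /= (Cz u Cu) h1 h2.
Qed.

Lemma level_point y a b : a < b -> exists2 x, a < x < b & f x = y.
Proof.
move=> /(fP y)[C [[_ [x Cx]] Cab Cy]]; exists x; last exact: Cy.
by have := Cab x Cx; rewrite /= in_itv.
Qed.

Lemma perfect_levels_pc : PeripherallyContinuous R f.
Proof.
move=> x U V oU Ux oV Vfx.
have /nbhs_ballP[d /= d0 hd] := open_nbhs_nbhs (conj oU Ux).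
have [a /andP[a1 a2] fa] := @level_point (f x) (x - d) x ltac:(by rewrite ltrBlDr ltrDl).
have [b /andP[b1 b2] fb] := @level_point (f x) x (x + d) ltac:(by rewrite ltrDl).
exists `]a, b[%classic; split.
- exact: interval_open.
- move=> z /=; rewrite in_itv /= => /andP[az zb]; apply: hd.
  by rewrite /ball /= ltr_norml; apply/andP; split; lra.
- by rewrite /= in_itv /= a2 b1.
- move=> _ [z [cz niz] <-].
  have : closed `[a, b]%classic by exact: interval_closed.
  move=> /(closure_id _).1 E.
  have : `[a, b]%classic z.
    rewrite E; apply: closureS cz => t /=; rewrite !in_itv /= => /andP[/ltW -> /ltW ->] //.
  rewrite /= in_itv /= => /andP[az zb].
  have nz : ~ (a < z < b).
    move=> azb; apply: niz; apply: open_nbhs_nbhs.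
    by split; [exact: interval_open|rewrite /= in_itv].
  have [<-|az'] := eqVneq a z; first by rewrite fa.
  have [->|zb'] := eqVneq z b; first by rewrite fb.
  by case: nz; rewrite !lt_neqAle az' az zb' zb.
Qed.

(** The road at [x] consists of [x] and of perfect pieces of its own level set
    that converge to [x] from both sides. *)
Lemma perfect_levels_pr : PR R f.
Proof.
move=> x.
have h0 n : 0 < n.+1%:R^-1 :> R by rewrite invr_gt0.
have exCl n : exists C : set R, [/\ perfect C,
    C `<=` `]x - n.+1%:R^-1, x[ & forall z, C z -> f z = f x].
  by apply: fP; rewrite ltrBlDr ltrDl.
have exCr n : exists C : set R, [/\ perfect C,
    C `<=` `]x, x + n.+1%:R^-1[ & forall z, C z -> f z = f x].
  by apply: fP; rewrite ltrDl.
have [Cl hCl] := choice exCl; have [Cr hCr] := choice exCr.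
pose P := [set x] `|` \bigcup_n (Cl n `|` Cr n).
have near_x n z : (Cl n `|` Cr n) z -> `|x - z| < n.+1%:R^-1.
  move=> [Cz|Cz]; [have [_ /(_ z Cz) + _] := hCl n|have [_ /(_ z Cz) + _] := hCr n];
    rewrite /= in_itv /= ltr_norml => /andP[]; move: n.+1%:R^-1 => t h1 h2;
    apply/andP; split; lra.
have limL : limit_point (P `&` `]-oo, x[) x.
  move=> U /nbhs_ballP[d /= d0 hd]; have [N /(_ N (leqnn N)) hN] := inv_small d0.
  have [[_ [z Cz]] Cx _] := hCl N; have := Cx z Cz; rewrite /= in_itv /= => /andP[_ zx].
  exists z; split; first by rewrite lt_eqF.
    by split; [right; exists N => //; left|rewrite /= in_itv].
  by apply: hd; rewrite /ball /= (lt_trans _ hN) //; apply: near_x; left.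
have limR : limit_point (P `&` `]x, +oo[) x.
  move=> U /nbhs_ballP[d /= d0 hd]; have [N /(_ N (leqnn N)) hN] := inv_small d0.
  have [[_ [z Cz]] Cx _] := hCr N; have := Cx z Cz; rewrite /= in_itv /= => /andP[zx _].
  exists z; split; first by rewrite gt_eqF.
    by split; [right; exists N => //; right|rewrite /= in_itv /= zx].
  by apply: hd; rewrite /ball /= (lt_trans _ hN) //; apply: near_x; right.
have clP : closed P.
  move=> y cy; have [->|yx] := eqVneq y x; first by left.
  have d0 : 0 < `|y - x| / 2 by rewrite divr_gt0 // normr_gt0 subr_eq0.
  have [N hN] := inv_small d0.
  have clN : closed (\bigcup_(n in `I_N) (Cl n `|` Cr n)).
    apply: closed_bigcup => [|n _]; first exact: finite_II.
    by apply: closedU; [have [[[]]] := hCl n|have [[[]]] := hCr n].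
  right; suff : (\bigcup_(n in `I_N) (Cl n `|` Cr n)) y by move=> [n _ ?]; exists n.
  apply: clN => U Uy.
  have [z [Pz [Uz yz]]] : P `&` (U `&` ball y (`|y - x| / 2)) !=set0.
    by apply: cy; apply: filterI => //; exact: nbhsx_ballx.
  exists z; split=> //; case: Pz => [zx|[n _ Cz]].
    by move: yz; rewrite zx /ball /= => yz; lra.
  exists n => //=; rewrite ltnNge; apply/negP => /hN.
  have := near_x n z Cz; move: yz; rewrite /ball /= => yz xz nd.
  have := ler_distD z y x; rewrite (distrC z x) => tri.
  by move: tri yz xz nd; move: (n.+1%:R^-1) => t tri yz xz nd; lra.
exists P; split=> //.
- split; last by exists x; left.
  split=> //; apply/seteqP; split=> [z /subset_limit_point|z].
    by rewrite -((closure_id P).1 clP).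
  have mono A B u : A `<=` B -> limit_point A u -> limit_point B u.
    by move=> AB lA U /lA[w [? /AB ? ?]]; exists w.
  move=> [->|[n _ [Cz|Cz]]].
  + by apply: mono limL => ? [].
  + have [[[_ E] _] _ _] := hCl n; rewrite -E in Cz; apply: mono Cz => w ?.
    by right; exists n => //; left.
  + have [[[_ E] _] _ _] := hCr n; rewrite -E in Cz; apply: mono Cz => w ?.
    by right; exists n => //; right.
- apply: cvg_near_cst; apply: filterS (withinT P (nbhs_filter x)).
  move=> z [->//|[n _ [Cz|Cz]]].
    by have [_ _ h] := hCl n; exact: h.
  by have [_ _ h] := hCr n; exact: h.
Qed.

End PerfectLevels.

(** * The basic ladder *)

Definition cluster_point (R : realType) (u : nat -> R) (l : R) : Prop :=
  forall (d : R) N, 0 < d -> exists2 n, (N <= n)%N & `|u n - l| < d.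

Lemma bounded_cluster_point (R : realType) (u : nat -> R) (B : R) :
  (forall N, exists2 n, (N <= n)%N & `|u n| <= B) -> exists l, cluster_point u l.
Proof.
move=> bu; have [g hg] : {g : nat -> nat & forall N, (N <= g N)%N /\ `|u (g N)| <= B}.
  by apply: (@choice _ _ (fun N n => (N <= n)%N /\ `|u n| <= B)) => N; have [n] := bu N; exists n.
have bg : bounded_fun (u \o g).
  exists B; split; first exact: num_real.
  by move=> M BM x _ /=; apply: le_trans (ltW BM); have [] := hg x.
have [j ij /cvg_ex[/= l lim]] := bolzano_weierstrass bg.
have jn n : (n <= j n)%N.
  by elim: n => // n IH; rewrite (leq_ltn_trans IH) // (leqW_mono ij).
exists l => d N d0; move/cvgrPdist_lt : lim => /(_ d d0)[M _ hM].
exists (g (j (maxn N M))).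
  by apply: leq_trans (hg _).1; apply: leq_trans (jn _); exact: leq_maxl.
by rewrite distrC; apply: hM => /=; exact: leq_maxr.
Qed.

Section Base.
Variables (R : realType) (e : R) (q : nat -> R).
Implicit Types (x y d : R) (n m N B : nat) (k : int).

Local Notation pos := (pos e).
Local Notation kap := (kap e).
Local Notation cbox := (cbox e).
Local Notation pt := (pt e).

(** A trapezoidal bump over the [k]-th box: it vanishes at both ends and is
    equal to 1 over the middle three quarters. *)
Definition bump n k x : R :=
  Num.min 1 (8 * Num.min (pos n x - k%:~R) (k%:~R + 1 - pos n x)).
Definition theta n x := bump n (kap n x) x.

(** Level by level, the function is deformed inside each box towards a target
    value, which is reached over the middle part of the box. *)
Fixpoint stage n : (R -> R) * (R -> nat) :=
  if n is m.+1 then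
    let v := (stage m).1 in let M := (stage m).2 in
    (fun x => v x + theta m x * ((if `|q m| <= (M x)%:R then q m else 0) - v x),
     fun x => (M x + (`|v (pt m (kap m x))| <= 1)%R)%N)
  else (fun=> 0, fun=> 0%N).

Definition bv n : R -> R := (stage n).1.
(** The number of earlier levels at which the box around [x] started from a value
    of modulus at most 1. A target is used only if it does not exceed this number;
    without such a restriction the values at some points could diverge to infinity,
    and these points would be left without a cluster value. *)
Definition cap n : R -> nat := (stage n).2.
Definition target n x : R := if `|q n| <= (cap n x)%:R then q n else 0.

Lemma bvS n x : bv n.+1 x = bv n x + theta n x * (target n x - bv n x).
Proof. by []. Qed.

Lemma capS n x : cap n.+1 x = (cap n x + (`|bv n (pt n (kap n x))| <= 1)%R)%N.
Proof. by []. Qed.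

Lemma cap_le n x : (cap n x <= n)%N.
Proof. by elim: n => // n IH; rewrite capS -addn1 leq_add //; case: (_ <= _)%R. Qed.

Lemma cap_mono n m x : (n <= m)%N -> (cap n x <= cap m x)%N.
Proof.
move=> /subnKC <-; elim: (m - n)%N => [|d IH]; first by rewrite addn0.
by rewrite addnS capS (leq_trans IH) // leq_addr.
Qed.

Lemma cap_const n x y : kap n x = kap n y -> cap n x = cap n y.
Proof.
elim: n => // n IH E; have E' := kap_coarse_eq (leqnSn n) E.
by rewrite !capS IH // E'.
Qed.

Lemma target_const n x y : kap n x = kap n y -> target n x = target n y.
Proof. by move=> E; rewrite /target (cap_const E). Qed.

Lemma target_le n x : `|target n x| <= (cap n x)%:R.
Proof. by rewrite /target; case: ifP => //; rewrite normr0 ler0n. Qed.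

Lemma bump_ge0 n k x : cbox n k x -> 0 <= bump n k x.
Proof.
move=> /andP[h1 h2]; rewrite /bump le_min ler01 mulr_ge0 // le_min.
by rewrite !subr_ge0 h1.
Qed.

Lemma bump_le1 n k x : bump n k x <= 1.
Proof. by rewrite /bump ge_min lexx. Qed.

Lemma bump_grid n k x : cbox n k x -> grid e n x -> bump n k x = 0.
Proof.
move=> bx gx; apply/le_anti; rewrite bump_ge0 // andbT /bump ge_min.
move: bx; rewrite /cbox (grid_pos gx) -[1]/(1%:~R) -intrD !ler_int => bx.
apply/orP; right; rewrite pmulr_rle0 // ge_min -!intrB !lerz0; lia.
Qed.

Lemma bump_lip n k x y : `|bump n k x - bump n k y| <= 8 * `|pos n x - pos n y|.
Proof.
have minD (a b a' b' D : R) : a <= a' + D -> b <= b' + D ->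
    Num.min a b <= Num.min a' b' + D.
  by move=> h1 h2; case: (leP a' b') => _; rewrite ge_min ?h1 ?h2 ?orbT.
have one z t : bump n k z - bump n k t <= 8 * `|pos n z - pos n t|.
  have h1 := ler_norm (pos n z - pos n t).
  have := ler_norm (pos n t - pos n z); rewrite distrC => h2.
  rewrite lerBlDl /bump; apply: (minD _ _ _ _ _); first by rewrite lerDl mulr_ge0.
  rewrite -mulrDr ler_pM2l //; apply: (minD _ _ _ _ _); lra.
by rewrite ler_norml lerNl opprB one distrC one.
Qed.

Lemma theta_grid n x : grid e n x -> theta n x = 0.
Proof. by move=> gx; apply: bump_grid => //; exact: cbox_kap. Qed.

Lemma bv_grid n x : grid e n x -> bv n.+1 x = bv n x.
Proof. by move=> gx; rewrite bvS theta_grid // mul0r addr0. Qed.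

Lemma bvS_box n k x : cbox n k x ->
  bv n.+1 x = bv n x + bump n k x * (target n (pt n k) - bv n x).
Proof.
move=> bx; rewrite bvS /theta.
have [gx|ng] := pselect (grid e n x).
  by rewrite !bump_grid //; [rewrite !mul0r|exact: cbox_kap].
have wx : obox e n k x by apply: contrapT => /(cbox_notobox bx).
by rewrite (@target_const n (pt n k) x) ?kap_pt (obox_kapE wx).
Qed.

Lemma bv_le n x : `|bv n x| <= (cap n x)%:R.
Proof.
elim: n => [|n IH]; first by rewrite normr0.
have t0 : 0 <= theta n x by apply: bump_ge0; exact: cbox_kap.
have t1 : theta n x <= 1 by exact: bump_le1.
have := target_le n x; move: IH; rewrite bvS !ler_norml => /andP[a1 a2] /andP[a3 a4].
have : (cap n x)%:R <= (cap n.+1 x)%:R :> R by rewrite ler_nat cap_mono.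
move: (theta n x) t0 t1 (target n x) a3 a4 (cap n.+1 x)%:R => t t0 t1 s a3 a4 c hc.
by apply/andP; split; nra.
Qed.

(** The new slopes at level [n] come from the bump, of slope [8 * W n], between
    two values that are at most [n]; the ratio of consecutive widths beats this. *)
Lemma bv_lip n k x y : cbox n k x -> cbox n k y ->
  `|bv n x - bv n y| <= W R n / n.+1%:R * `|x - y|.
Proof.
elim: n k x y => [|n IH] k x y bx byy.
  by rewrite subrr normr0 mulr_ge0 // divr_ge0 // ltW // W_gt0.
have := kap_pt e n.+1 k => Ek; rewrite -Ek in bx byy.
have {bx}bx := cbox_coarse (leqnSn n) bx.
have {byy}byy := cbox_coarse (leqnSn n) byy.
move: bx byy; set k' := kap n _ => bx byy.
rewrite (bvS_box bx) (bvS_box byy).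
have := IH k' x y bx byy; have := bump_ge0 bx; have := bump_le1 n k' x.
have := bump_lip n k' x y.
rewrite posB normrM (gtr0_norm (W_gt0 R n)).
have ht : `|target n (pt n k')| <= n%:R.
  by apply: le_trans (target_le _ _) _; rewrite ler_nat cap_le.
have hv : `|bv n y| <= n%:R.
  by apply: le_trans (bv_le _ _) _; rewrite ler_nat cap_le.
set t := target _ _ in ht *; set vx := bv n x; set vy := bv n y in hv *.
set bx' := bump n k' x; set by' := bump n k' y; move: (normr_ge0 (x - y)).
move: `|x - y| => D D0 h1 h2 h3 h4.
have -> : vx + bx' * (t - vx) - (vy + by' * (t - vy)) =
    (1 - bx') * (vx - vy) + (bx' - by') * (t - vy) by ring.
apply: le_trans (ler_normD _ _) _; rewrite !normrM ger0_norm ?subr_ge0 //.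
have htv : `|t - vy| <= 2 * n%:R.
  by apply: le_trans (ler_normB _ _) _; lra.
have W0 := W_gt0 R n.
(* The ratio of the widths is [16 * (n + 2) ^ 2], and [16 * (n + 2)] is
   [1 + (16 * n + 31)]; the first summand is for the old slope. *)
have -> : W R n.+1 / n.+2%:R * D = W R n * D + (W R n * D) * (16 * n%:R + 31).
  rewrite WS -[n.+2%:R]natr1 -[n.+1%:R]natr1.
  have n2 : n%:R + 1 + 1 != 0 :> R by rewrite !natr1 pnatr_eq0.
  by field.
apply: lerD.
  apply: le_trans (_ : `|vx - vy| <= _); first by rewrite ler_piMl // gerBl.
  apply: le_trans h4 _; rewrite ler_wpM2r // ler_piMr ?(ltW W0) //.
  by rewrite invf_le1 ?ltr0n // ler1n.
apply: le_trans (_ : (8 * (D * W R n)) * (2 * n%:R) <= _); first by rewrite ler_pM.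
have : 0 <= W R n * D by rewrite mulr_ge0 // ltW.
by nra.
Qed.

Lemma bv_osc n k x y : cbox n k x -> cbox n k y ->
  `|bv n x - bv n y| <= n.+1%:R^-1.
Proof.
move=> bx byy; apply: le_trans (bv_lip bx byy) _.
rewrite mulrAC ler_piMl ?invr_ge0 // -(mulfV (lt0r_neq0 (W_gt0 R n))).
by rewrite ler_pM2l ?W_gt0 // (cbox_dist bx byy).
Qed.

Lemma bv_continuous n : continuous (bv n).
Proof.
move=> x; apply/cvgrPdist_lt => d d0.
have W0 : 0 < W R n / n.+1%:R by rewrite divr_gt0 ?W_gt0.
have near1 : \forall y \near x, `|x - y| < d / (W R n / n.+1%:R).
  by apply/nbhs_ballP; exists (d / (W R n / n.+1%:R)) => //=; rewrite divr_gt0.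
apply: filterS2 near1 (near_cbox e n x) => y; rewrite ltr_pdivlMr // => h bx.
apply: le_lt_trans (bv_lip bx (cbox_kap _ _ _)) _.
by rewrite mulrC.
Qed.

(** The values cannot escape to infinity at [x]: if the caps stay bounded, then
    they bound the values, and if not, then infinitely many values are small. *)
Lemma bv_cluster x : exists l, cluster_point (fun n => bv n x) l.
Proof.
have [[B hB]|/forallNP unb] := pselect (exists B, forall n, (cap n x <= B)%N).
  apply: (@bounded_cluster_point _ _ B%:R) => N; exists N => //.
  by apply: le_trans (bv_le N x) _; rewrite ler_nat.
apply: (@bounded_cluster_point _ _ 2) => N.
apply: contrapT => big; apply: (unb (cap N x)) => n.
have [/cap_mono//|/ltnW /subnKC <-] := leqP n N.
elim: (n - N)%N => [|j IH]; first by rewrite addn0.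
rewrite addnS; apply: leq_trans IH; rewrite leqNgt; apply/negP => small.
apply: big; exists (N + j)%N; first exact: leq_addr.
have : `|bv (N + j) (pt (N + j) (kap (N + j) x))| <= 1.
  by move: small; rewrite capS; case: (_ <= 1)%R => //; rewrite addn0 ltnn.
set z := pt _ _ => hz.
have := @bv_osc (N + j) (kap (N + j) x) x z (cbox_kap _ _ _).
move=> /(_ (_ : cbox (N + j) (kap (N + j) x) z)) h.
have : `|bv (N + j) x - bv (N + j) z| <= 1.
  apply: le_trans (h _) _; last by rewrite invf_le1 ?ltr0n // ler1n.
  by have := cbox_kap e (N + j) z; rewrite kap_pt.
have := ler_distD 0 (bv (N + j) x - bv (N + j) z) (- bv (N + j) z).
by rewrite !subr0 opprK subrK add0r; lra.
Qed.

(** At such a point the ladder takes every rational value infinitely often, so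
    that every real number is a cluster value and nothing has to be prescribed. *)
Definition free x : Prop := forall (s : rat) N,
  exists2 n, (N <= n)%N & theta n x = 1 /\ q n = ratr s.

Lemma bv_theta1 n x : theta n x = 1 -> bv n.+1 x = target n x.
Proof. by move=> h; rewrite bvS h mul1r addrC subrK. Qed.

(** Each passage through the target 0 raises the cap. *)
Lemma cap_free x B : free x -> exists n, (B <= cap n x)%N.
Proof.
move=> fx; elim: B => [|B [n IH]]; first by exists 0%N.
have [m nm [th qm]] := fx 0 n; exists m.+2; rewrite capS.
have v0 : bv m.+1 x = 0 by rewrite bv_theta1 // /target qm rmorph0; case: ifP.
have bz : cbox m.+1 (kap m.+1 x) (pt m.+1 (kap m.+1 x)).
  by have := cbox_kap e m.+1 (pt m.+1 (kap m.+1 x)); rewrite kap_pt.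
have := bv_osc (cbox_kap e m.+1 x) bz; rewrite v0 sub0r normrN => h.
rewrite (le_trans h) ?invf_le1 ?ltr0n ?ler1n // addn1 ltnS.
by apply: leq_trans IH _; apply: cap_mono; exact: leqW.
Qed.

Lemma free_value x (s : rat) N : free x -> exists2 n, (N <= n)%N & bv n x = ratr s.
Proof.
move=> fx; have [B hB] : exists B : nat, `|ratr s| <= B%:R :> R.
  by exists (Num.truncn `|ratr s : R|).+1; apply: ltW; exact: truncnS_gt.
have [n0 hn0] := cap_free B fx; have [m] := fx s (maxn N n0).
rewrite geq_max => /andP[Nm n0m] [th qm]; exists m.+1; first exact: leqW.
rewrite bv_theta1 // /target qm (le_trans hB) // ler_nat.
by apply: leq_trans hn0 _; exact: cap_mono.
Qed.

Lemma base_ladder (a : R) (f : R -> R) : a != 0 ->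
  (forall x, ~ free x -> cluster_point (fun n => bv n x) (f x / a)) ->
  ladder e (fun n x => a * bv n x) f.
Proof.
move=> a0 hf; split.
- by move=> n x; apply: cvgM; [exact: cvg_cst|exact: bv_continuous].
- by move=> n x gx; rewrite bv_grid.
- exists `|a| => n k x y bx byy; rewrite -mulrBr normrM ler_wpM2l //.
  exact: bv_osc bx byy.
- move=> x d N d0; have a0' : 0 < `|a| by rewrite normr_gt0.
  suff [n Nn hn] : exists2 n, (N <= n)%N & `|bv n x - f x / a| < d / `|a|.
    exists n => //; rewrite -[f x](divfK a0) [_ / a * a]mulrC -mulrBr normrM.
    by rewrite mulrC -ltr_pdivlMr.
  have da : 0 < d / `|a| by rewrite divr_gt0.
  have [fx|/hf] := pselect (free x); last exact.
  have [s] := @rat_in_itvoo R (f x / a - d / `|a|) (f x / a + d / `|a|) ltac:(lra).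
  rewrite in_itv /= => /andP[s1 s2]; have [n Nn hn] := free_value s N fx.
  by exists n => //; rewrite hn ltr_norml; apply/andP; split; lra.
Qed.

End Base.

(** * Expansions along the grids *)

Section Digits.
Variable R : realType.
Implicit Types (e x y a : R) (n m N : nat).

Definition dsum a (d : nat -> R) n : R := a + \sum_(j < n) d j / W R j.

Lemma dsumS a d n : dsum a d n.+1 = dsum a d n + d n / W R n.
Proof. by rewrite /dsum big_ord_recr addrA. Qed.

(** The ratio of consecutive widths is a multiple of 4, so moving by quarters of
    a box leads from grid points to grid points of the next level. *)
Lemma grid_step e n x c : grid e n x -> 4 * c \is a Num.int ->
  grid e n.+1 (x + c / W R n).
Proof.
move=> gx c4; rewrite /grid; have -> : pos e n.+1 (x + c / W R n) =
    pos e n x * (16 * n.+2 ^ 2)%:R + 4 * c * (4 * n.+2 ^ 2)%:R.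
  rewrite /pos WS !natrM ?natrX; have := lt0r_neq0 (W_gt0 R n) => W0; by field.
by apply: rpredD; rewrite rpredM ?rpred_nat.
Qed.

Lemma W_inv_S n : (W R n.+1)^-1 <= (W R n)^-1 / 64.
Proof.
rewrite WS invfM ler_pM2l ?invr_gt0 ?W_gt0 // lef_pV2 ?posrE ?mulr_gt0 ?exprn_gt0 ?ltr0n //.
by rewrite -natrX -natrM ler_nat; lia.
Qed.

Definition digits (d : nat -> R) : Prop := forall n, 0 <= d n <= 1 / 2.

Lemma dsum_mono a d n m : digits d -> (n <= m)%N -> dsum a d n <= dsum a d m.
Proof.
move=> hd /subnKC <-; elim: (m - n)%N => [|j IH]; first by rewrite addn0.
rewrite addnS dsumS (le_trans IH) // lerDl; have /andP[h _] := hd (n + j)%N.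
by rewrite divr_ge0 // ltW // W_gt0.
Qed.

Lemma dsum_upper a d n m : digits d -> (n <= m)%N ->
  dsum a d m + (W R m)^-1 <= dsum a d n + (W R n)^-1.
Proof.
move=> hd /subnKC <-; elim: (m - n)%N => [|j IH]; first by rewrite addn0.
rewrite addnS dsumS; apply: le_trans IH; rewrite -addrA lerD2l.
have := W_inv_S (n + j); have /andP[_] := hd (n + j)%N.
have : 0 < (W R (n + j))^-1 by rewrite invr_gt0 W_gt0.
move: (W R (n + j))^-1 (W R (n + j).+1)^-1 (d _) => u t s u0 su tu.
have : s * u <= 1 / 2 * u by rewrite ler_pM2r.
lra.
Qed.

Lemma dsum_limit a d : digits d ->
  exists x, forall n, dsum a d n <= x <= dsum a d n + (W R n)^-1.
Proof.
move=> hd; exists (sup (range (dsum a d))) => n.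
have ub m : ubound (range (dsum a d)) (dsum a d m + (W R m)^-1).
  move=> _ [j _ <-]; have [mj|/ltnW jm] := leqP m j.
    apply: le_trans (dsum_upper a hd mj).
    by rewrite lerDl invr_ge0 ltW // W_gt0.
  apply: le_trans (dsum_mono a hd jm) _.
  by rewrite lerDl invr_ge0 ltW // W_gt0.
apply/andP; split.
  by apply: ub_le_sup; [exists (dsum a d n + (W R n)^-1)|exists n].
by apply: ge_sup => //; exists (dsum a d 0), 0%N.
Qed.

(** The real number with the expansion [d]; digits up to one half leave enough
    room for all later levels. *)
Definition dlim a d : R := xget 0 [set x | forall n, dsum a d n <= x <= dsum a d n + (W R n)^-1].

Lemma dlimP a d : digits d ->
  forall n, dsum a d n <= dlim a d <= dsum a d n + (W R n)^-1.
Proof.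
by move=> /(dsum_limit a)[x hx]; rewrite /dlim; case: xgetP => [y _ //|/(_ x)/(_ hx)].
Qed.

End Digits.

(** * Level sets of the basic ladder *)

Section Levels.
Variables (R : realType) (e : R) (q : nat -> R).
Implicit Types (x y d : R) (n m N B : nat).

Hypothesis q_often : forall (s : rat) N, exists2 n, (N <= n)%N & q n = ratr s.

Local Notation bv := (bv e q).
Local Notation cap := (cap e q).

Section Walk.
Variables (S : pred nat) (b : nat -> bool) (N : nat) (p : R).
Hypothesis gp : grid e N p.

(** At the levels in [S] the walk moves into the middle part of the current box,
    where the target is reached; there are two possible moves, selected by [b],
    and this binary choice makes the set of limits perfect. At the other levels it
    stays at the left end of the box, where the value is preserved. *)
Definition wdigit m : R :=
  if (N <= m)%N && S m then (if b m then 1 / 2 else 1 / 4) else 0.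
Definition walk m := dsum p wdigit m.
Definition wlim := dlim p wdigit.

Lemma wdigit_digits : digits wdigit.
Proof. by move=> m; rewrite /wdigit; case: ifP => _; [case: ifP => _|]; lra. Qed.

Lemma walkS m : walk m.+1 = walk m + wdigit m / W R m.
Proof. exact: dsumS. Qed.

Lemma walk_start m : (m <= N)%N -> walk m = p.
Proof.
move=> mN; rewrite /walk /dsum big1 ?addr0 // => j _.
by rewrite /wdigit leqNgt (leq_trans (ltn_ord j) mN) mul0r.
Qed.

Lemma walk_grid m : (N <= m)%N -> grid e m (walk m).
Proof.
move=> /subnKC <-; elim: (m - N)%N => [|j IH]; first by rewrite addn0 walk_start.
rewrite addnS walkS; apply: grid_step => //; rewrite /wdigit.
case: ifP => _; last by rewrite mulr0 rpred0.
case: ifP => _; last by rewrite mulrCA mulfV // mulr1 rpred1.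
by rewrite (_ : 4 * (1 / 2) = 2%:R) ?rpred_nat //; field.
Qed.

Lemma pos_walkS m : (N <= m)%N ->
  pos e m (walk m.+1) = (kap e m (walk m))%:~R + wdigit m.
Proof.
move=> Nm; rewrite -(grid_pos (walk_grid Nm)) walkS /pos.
have := lt0r_neq0 (W_gt0 R m) => W0; by field.
Qed.

Lemma kap_walkS m : (N <= m)%N -> kap e m (walk m.+1) = kap e m (walk m).
Proof.
move=> Nm; apply: kap_eq; rewrite pos_walkS //.
by have /andP[? ?] := wdigit_digits m; apply/andP; split; lra.
Qed.

Lemma cap_walkS m : (N <= m)%N ->
  cap m.+1 (walk m.+1) = (cap m (walk m) + (`|bv m (walk m)| <= 1)%R)%N.
Proof.
move=> Nm; rewrite capS kap_walkS // (pt_kap (walk_grid Nm)).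
by rewrite (cap_const q (kap_walkS Nm)).
Qed.

Lemma cap_walk_mono n m : (N <= n)%N -> (n <= m)%N -> (cap n (walk n) <= cap m (walk m))%N.
Proof.
move=> Nn /subnKC <-; elim: (m - n)%N => [|j IH]; first by rewrite addn0.
by rewrite addnS cap_walkS ?(leq_trans Nn) ?leq_addr // (leq_trans IH) ?leq_addr.
Qed.

Lemma bv_walk_stay m : (N <= m)%N -> ~~ S m -> bv m.+1 (walk m.+1) = bv m (walk m).
Proof.
move=> Nm nS; rewrite walkS /wdigit (negbTE nS) andbF mul0r addr0.
by rewrite (bv_grid q (walk_grid Nm)).
Qed.

Lemma bv_walk_move m : (N <= m)%N -> S m -> bv m.+1 (walk m.+1) = target e q m (walk m).
Proof.
move=> Nm Sm; rewrite bv_theta1; first by apply: target_const; exact: kap_walkS.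
rewrite /theta kap_walkS // /bump pos_walkS // /wdigit Nm Sm /=.
set t := if _ then _ else _; have ht : 1 / 4 <= t <= 1 / 2 by rewrite /t; case: ifP; lra.
move: (kap e m _)%:~R => K; have -> : K + t - K = t by ring.
have -> : K + 1 - (K + t) = 1 - t by ring.
by case/andP: ht => ? ?; rewrite min_l //; case: (leP t (1 - t)) => _; lra.
Qed.

Lemma wlimP m : walk m <= wlim <= walk m + (W R m)^-1.
Proof. exact: (dlimP p wdigit_digits m). Qed.

Lemma cbox_wlim m : (N <= m)%N -> cbox e m (kap e m (walk m)) wlim.
Proof.
move=> Nm; have /andP[h1 h2] := wlimP m; rewrite /cbox.
rewrite -(grid_pos (walk_grid Nm)) /pos ler_pM2r ?W_gt0 // lerD2r h1 /=.
rewrite -(mulVf (lt0r_neq0 (W_gt0 R m))) -mulrDl ler_pM2r ?W_gt0 //.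
by rewrite addrAC lerD2r.
Qed.

Lemma bv_wlim m : (N <= m)%N -> `|bv m wlim - bv m (walk m)| <= m.+1%:R^-1.
Proof. by move=> Nm; apply: bv_osc (cbox_wlim Nm) (cbox_kap _ _ _). Qed.

Lemma walk_within m : (N <= m)%N -> p <= walk m /\ walk m + (W R m)^-1 <= p + (W R N)^-1.
Proof.
move=> Nm; have h := dsum_mono p wdigit_digits Nm; have h' := dsum_upper p wdigit_digits Nm.
by rewrite -!/(walk _) (walk_start (leqnn N)) in h h'.
Qed.

End Walk.

Lemma walk_agree S b b' N p m : (forall j, (j < m)%N -> b j = b' j) ->
  walk S b N p m = walk S b' N p m.
Proof.
move=> bb'; congr (_ + _); apply: eq_bigr => j _.
by rewrite /wdigit bb'.
Qed.

(** After a single move to the target 0, staying raises the cap at each level. *)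
Lemma high_cap x y B : x < y -> exists N p,
  [/\ grid e N p, (B <= cap N p)%N, x < p & p + (W R N)^-1 < y].
Proof.
move=> xy; have [n0 /(_ n0 (leqnn _)) hn] := @inv_small R ((y - x) / 2) ltac:(lra).
have [z xz zy] : exists2 z, z - x = (y - x) / 2 & y - z = (y - x) / 2.
  by exists ((x + y) / 2); field.
pose p := pt e n0 (kap e n0 z).
have gp : grid e n0 p by exact: grid_pt.
have /andP[c1 c2] := cbox_kap e n0 z.
have Winv := le_lt_trans (W_inv_le R n0) hn.
have mid : p <= z <= p + (W R n0)^-1.
  have E : pos e n0 p = (kap e n0 z)%:~R by rewrite pos_pt.
  rewrite -E /pos ler_pM2r ?W_gt0 // lerD2r in c1; rewrite c1 /=.
  rewrite -E /pos -(mulVf (lt0r_neq0 (W_gt0 R n0))) -mulrDl ler_pM2r ?W_gt0 // in c2.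
  by rewrite addrAC lerD2r in c2.
have [n n0n qn] := q_often 0 n0; rewrite rmorph0 in qn.
pose S m := m == n; pose w := walk S xpredT n0 p.
have zero j : bv (n.+1 + j) (w (n.+1 + j)%N) = 0.
  elim: j => [|j IH].
    rewrite addn0 bv_walk_move //; last by rewrite /S.
    by rewrite /target qn; case: ifP.
  rewrite addnS bv_walk_stay // ?IH //; last by rewrite /S gtn_eqF // leq_addr.
  by rewrite (leq_trans n0n) // ltnW // leq_addr.
exists (n.+1 + B)%N, (w (n.+1 + B)%N).
have n0N : (n0 <= n.+1 + B)%N by rewrite (leq_trans n0n) // ltnW // leq_addr.
split; first exact: walk_grid.
- elim: B {n0N} => [//|B IH]; rewrite addnS cap_walkS //; last first.
    by rewrite (leq_trans n0n) // ltnW // leq_addr.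
  by rewrite zero normr0 ler01 addn1 ltnS.
- have [h _] := walk_within S xpredT p n0N.
  by apply: lt_le_trans h; case/andP: mid => _; move: (W R n0)^-1 Winv => u; lra.
- have [_ h] := walk_within S xpredT p n0N.
  by apply: le_lt_trans h _; case/andP: mid => + _; move: (W R n0)^-1 Winv => u; lra.
Qed.

Section Approach.
Variables (y : R) (N : nat) (p : R).
Hypotheses (gp : grid e N p) (capN : `|y| + 1 <= (cap N p)%:R).

(** The tolerance around [y] shrinks with each move, yet every tolerance is met
    again by a later target: the moves never stop, and their targets tend to [y]. *)
Fixpoint moves m : nat :=
  if m is j.+1 then (moves j + ((N <= j) && (`|q j - y| < (moves j).+1%:R^-1)%R))%N
  else 0%N.
Definition moving m := (N <= m)%N && (`|q m - y| < (moves m).+1%:R^-1).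

Lemma movesS m : moves m.+1 = (moves m + moving m)%N.
Proof. by []. Qed.

Lemma moves_mono n m : (n <= m)%N -> (moves n <= moves m)%N.
Proof.
move=> /subnKC <-; elim: (m - n)%N => [|j IH]; first by rewrite addn0.
by rewrite addnS movesS (leq_trans IH) // leq_addr.
Qed.

Lemma moving_often M : exists2 m, (M <= m)%N & moving m.
Proof.
apply: contrapT => none.
have stuck j : moves (M + j) = moves M.
  elim: j => [|j IH]; first by rewrite addn0.
  rewrite addnS movesS IH; case E: (moving _); last by rewrite addn0.
  by case: none; exists (M + j)%N => //; exact: leq_addr.
have d0 : 0 < (moves M).+1%:R^-1 :> R by rewrite invr_gt0.
have [s] := @rat_in_itvoo R (y - (moves M).+1%:R^-1) (y + (moves M).+1%:R^-1)
  ltac:(by rewrite ltrBlDr -addrA ltrDl addr_gt0).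
rewrite in_itv /= => /andP[s1 s2]; have [m] := q_often s (maxn M N).
rewrite geq_max => /andP[Mm Nm] qm; apply: none; exists m => //.
have Em : moves m = moves M by rewrite -(subnKC Mm) stuck.
rewrite /moving Nm /= qm Em ltr_norml.
by move: (moves M).+1%:R^-1 s1 s2 => t s1 s2; apply/andP; split; lra.
Qed.

Lemma moves_unbounded K : exists2 m, (N <= m)%N & (K <= moves m)%N.
Proof.
elim: K => [|K [m Nm Km]]; first by exists N.
have [j mj sj] := moving_often m; exists j.+1; first by rewrite (leq_trans Nm) // leqW.
by rewrite movesS sj addn1 ltnS (leq_trans Km) // moves_mono.
Qed.

Lemma moves0 m : (m <= N)%N -> moves m = 0%N.
Proof.
elim: m => // m IH mN; rewrite movesS IH; last exact: ltnW.
by rewrite /moving leqNgt mN.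
Qed.

Variable b : nat -> bool.
Local Notation w := (walk moving b N p).
Local Notation x := (wlim moving b N p).

(** After a move at which the count becomes [k] the value is within [1/k] of [y],
    and it does not change before the next move. *)
Lemma walk_value m : (N <= m)%N -> (0 < moves m)%N ->
  `|bv m (w m) - y| < (moves m)%:R^-1.
Proof.
move=> /subnKC <-; elim: (m - N)%N => [|j IH]; first by rewrite addn0 moves0.
rewrite addnS; have Nj : (N <= N + j)%N by exact: leq_addr.
have [mj|nmj] := boolP (moving (N + j)); last first.
  by rewrite movesS (negbTE nmj) addn0 bv_walk_stay.
move=> _; rewrite bv_walk_move // movesS mj addn1.
have /andP[_ close] := mj; rewrite /target ifT //.
have c1 : (moves (N + j)).+1%:R^-1 <= 1 :> R by rewrite invf_le1 ?ltr0n // ler1n.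
have cw : (cap N p)%:R <= (cap (N + j) (w (N + j)%N))%:R :> R.
  rewrite ler_nat; have := @cap_walk_mono moving b N p gp N (N + j) (leqnn N) Nj.
  by rewrite walk_start.
apply: le_trans cw; apply: le_trans capN; have := ler_distD 0 (q (N + j)%N - y) (- y).
by rewrite !subr0 opprK subrK add0r; move: close c1; move: (moves _).+1%:R^-1 => t; lra.
Qed.

Lemma wlim_value d : 0 < d -> exists M, forall n, (M <= n)%N -> `|bv n x - y| < d.
Proof.
move=> d0; have [K hK] := @inv_small R (d / 2) ltac:(by rewrite divr_gt0).
have [m Nm Km] := moves_unbounded K.+1; exists (maxn m K) => n.
rewrite geq_max => /andP[mn /hK nd].
have Nn := leq_trans Nm mn; have Kn := leq_trans Km (moves_mono mn).
have h1 := bv_wlim moving b gp Nn.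
have h2 := walk_value Nn (leq_ltn_trans (leq0n K) Kn).
have h3 : (moves n)%:R^-1 <= K.+1%:R^-1 :> R.
  by rewrite lef_pV2 ?posrE ?ltr0n ?ler_nat // (leq_ltn_trans (leq0n K) Kn).
have := hK K (leqnn K); have := ler_distD (bv n (w n)) (bv n x) y.
move: h1 h2 h3 nd; move: n.+1%:R^-1 (moves n)%:R^-1 K.+1%:R^-1 => t1 t2 t3.
by move=> *; lra.
Qed.

End Approach.

Lemma wlim_dist y N p (b b' : nat -> bool) m : (forall j, (j < m)%N -> b j = b' j) ->
  `|wlim (moving y N) b N p - wlim (moving y N) b' N p| <= (W R m)^-1.
Proof.
move=> bb'; have := wlimP (moving y N) b N p m; have := wlimP (moving y N) b' N p m.
rewrite (walk_agree _ _ _ bb') => /andP[h1 h2] /andP[h3 h4].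
by rewrite ler_norml; move: (W R m)^-1 h2 h4 => t h2 h4; apply/andP; split; lra.
Qed.

Lemma wlim_continuous y N p :
  continuous (fun b : cantor_space => wlim (moving y N) b N p).
Proof.
move=> b; apply/cvgrPdist_lt => d d0; have [m /(_ m (leqnn m)) hm] := inv_small d0.
have agree (j : 'I_m) : nbhs b (fun b' : cantor_space => b (val j) = b' (val j)).
  have nb : nbhs (b (val j) : bool) [set c | b (val j) = c].
    by rewrite nbhs_principalE; exact/principal_filterP.
  exact: (@proj_continuous nat (fun=> bool) (val j) b _ nb).
have all_agree : nbhs b (fun b' : cantor_space => forall j : 'I_m, b (val j) = b' (val j)).
  exact: (@filter_forall cantor_space 'I_m (fun j b' => b (val j) = b' (val j))
    (nbhs b) (@nbhs_filter cantor_space b) agree).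
near=> b'; have hb : forall j : 'I_m, b (val j) = b' (val j) by near: b'.
apply: le_lt_trans (le_lt_trans (W_inv_le R m) hm).
by apply: wlim_dist => j jm; exact: (hb (Ordinal jm)).
Unshelve. all: by end_near. Qed.

(** Changing the choice at a late move gives another limit point nearby; the
    two moves differ by more than all later moves can compensate. *)
Lemma wlim_perfect y N p : perfect (range (fun b => wlim (moving y N) b N p)).
Proof.
set x := fun b => wlim (moving y N) b N p.
have clx : closed (range x).
  apply: compact_closed; first exact: Rhausdorff.
  apply: (@continuous_compact cantor_space R x setT); last exact: cantor_space_compact.
  by apply: continuous_subspaceT; exact: wlim_continuous.
split; last by exists (x xpredT), xpredT.
split=> //; apply/seteqP; split=> [z /subset_limit_point|].
  by rewrite -((closure_id _).1 clx).
move=> _ [b _ <-] U /nbhs_ballP[d /= d0 hd]; have [M hM] := inv_small d0.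
have [m /hM hm mm] := moving_often y N M.
pose b' j := if j == m then ~~ b j else b j.
have bb' j : (j < m)%N -> b' j = b j by move=> jm; rewrite /b' ltn_eqF.
exists (x b'); split; [|by exists b'|]; last first.
  apply: hd; rewrite /ball /= distrC.
  exact: le_lt_trans (wlim_dist y N p bb') (le_lt_trans (W_inv_le R m) hm).
apply/eqP => E; have := wlimP (moving y N) b N p m.+1.
have := wlimP (moving y N) b' N p m.+1; rewrite -/(x b) -/(x b') E !walkS.
rewrite (walk_agree _ _ _ bb'); set u := walk _ _ _ _ _.
have /andP[Nm _] := mm; rewrite /wdigit Nm mm /= /b' eqxx.
have := W_inv_S R m; have : 0 < (W R m)^-1 by rewrite invr_gt0 W_gt0.
move: (x b) (W R m)^-1 (W R m.+1)^-1 => z t t' t0 tt'.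
by case: (b m) => /= /andP[h1 h2] /andP[h3 h4]; lra.
Qed.

Lemma bv_perfect_levels y u v : u < v -> exists C,
  [/\ perfect C, C `<=` `]u, v[ & forall x, C x -> forall d, 0 < d ->
    exists M, forall n, (M <= n)%N -> `|bv n x - y| < d].
Proof.
move=> uv; have [B hB] : exists B : nat, `|y| + 1 <= B%:R.
  by exists (Num.truncn (`|y| + 1)).+1; apply: ltW; exact: truncnS_gt.
have [N [p [gp Bc up pv]]] := high_cap B uv.
have capN : `|y| + 1 <= (cap N p)%:R by rewrite (le_trans hB) // ler_nat.
exists (range (fun b => wlim (moving y N) b N p)); split.
- exact: wlim_perfect.
- move=> _ [b _ <-]; rewrite /= in_itv /=; have := wlimP (moving y N) b N p N.
  rewrite walk_start // => /andP[h1 h2].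
  by rewrite (lt_le_trans up h1) (le_lt_trans h2 pv).
- by move=> _ [b _ <-] d d0; exact: wlim_value.
Qed.

End Levels.

(** * A family of basic ladders with disjoint prescriptions *)

Definition prefix_of (t : nat -> bool) (p : seq bool) : bool := p == mkseq t (size p).

Definition lookup (t : nat -> bool) (l : seq (seq bool * (rat * bool))) : rat * bool :=
  if [seq x <- l | prefix_of t x.1] is x :: _ then x.2 else (0, false).

(** The exponent of 2 in [n] takes every value infinitely often, hence every table
    is used at infinitely many levels. *)
Definition table n : seq (seq bool * (rat * bool)) := odflt [::] (unpickle (logn 2 n)).

Definition label t n : rat * bool := lookup t (table n).

Lemma table_often l N : exists2 n, (N <= n)%N & table n = l.
Proof.
exists (2 ^ pickle l * N.*2.+1)%N.
  by rewrite (leq_trans _ (leq_pmull _ _)) ?expn_gt0 // -addnn -addnS leq_addr.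
rewrite /table lognM ?expn_gt0 // pfactorK // logn_coprime ?addn0 ?pickleK //.
by rewrite coprime2n /= odd_double.
Qed.

(** Distinct indices are told apart by prefixes, so a single table can give them
    independent labels. *)
Lemma label_pair t t' (a a' : rat * bool) N : t <> t' ->
  exists2 n, (N <= n)%N & label t n = a /\ label t' n = a'.
Proof.
move=> tt'; have [i ti] : exists i, t i != t' i.
  apply: contrapT => /forallNP h; apply: tt'; apply/funext => i.
  by apply/eqP/negP => /negP /h.
have pp' : mkseq t i.+1 != mkseq t' i.+1.
  apply: contra ti => /eqP/(congr1 (fun s => nth false s i)).
  by rewrite !nth_mkseq // => ->.
have [n Nn tn] := table_often [:: (mkseq t i.+1, a); (mkseq t' i.+1, a')] N.
have hp : prefix_of t (mkseq t i.+1) by rewrite /prefix_of size_mkseq.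
have hp' : prefix_of t' (mkseq t' i.+1) by rewrite /prefix_of size_mkseq.
have np : prefix_of t' (mkseq t i.+1) = false.
  by rewrite /prefix_of size_mkseq (negbTE pp').
exists n => //; rewrite /label tn; move: (mkseq t i.+1) (mkseq t' i.+1) hp hp' np.
by move=> p p' hp hp' np; rewrite /lookup /= hp np hp'.
Qed.

(** The label of an index at a level consists of a target, and of a bit that says
    whether its grid is shifted at this level by half a box. *)
Section Family.
Variable R : realType.
Implicit Types (t : nat -> bool) (x y d : R) (n m N : nat).

Definition targets t n : R := ratr (label t n).1.
Definition shift_digit t n : R := if (label t n).2 then 1 / 2 else 0.
Definition shift t : R := dlim 0 (shift_digit t).

Lemma targets_often t (s : rat) N : exists2 n, (N <= n)%N & targets t n = ratr s.
Proof.
have tt' : t <> (fun i => ~~ t i) by move=> /(congr1 (@^~ 0%N)); case: (t 0%N).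
have [n Nn [E _]] := label_pair (s, false) (s, false) N tt'.
by exists n => //; rewrite /targets E.
Qed.

Lemma shift_expansion t n : exists2 i : int,
  i%:~R + shift_digit t n <= shift t * W R n &
  shift t * W R n <= i%:~R + shift_digit t n + 1 / 64.
Proof.
have dg : digits (shift_digit t) by move=> j; rewrite /shift_digit; case: ifP => _; lra.
have gr m : grid 0 m (dsum 0 (shift_digit t) m).
  elim: m => [|m IH]; first by rewrite /dsum big_ord0 addr0 /grid /pos subr0 mul0r rpred0.
  rewrite dsumS; apply: grid_step => //; rewrite /shift_digit.
  case: ifP => _; last by rewrite mulr0 rpred0.
  by rewrite (_ : 4 * (1 / 2) = 2%:R) ?rpred_nat //; field.
have E := grid_pos (gr n); rewrite /pos subr0 in E.
have /andP[h1 h2] := dlimP 0 dg n.+1; rewrite -/(shift t) dsumS in h1 h2.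
have W0 := W_gt0 R n; have Wn0 := lt0r_neq0 W0.
exists (kap 0 n (dsum 0 (shift_digit t) n)); rewrite -E.
  by rewrite -{1}(divfK Wn0 (shift_digit t n)) -mulrDl ler_pM2r.
apply: le_trans (_ : (dsum 0 (shift_digit t) n + shift_digit t n / W R n +
    (W R n)^-1 / 64) * W R n <= _).
  by rewrite ler_pM2r // (le_trans h2) // lerD2l W_inv_S.
by rewrite !mulrDl divfK // mulrAC mulVf.
Qed.

Lemma theta_near_int e n x : theta e n x != 1 ->
  exists j : int, `|pos e n x - j%:~R| < 1 / 8.
Proof.
have /andP[h1 h2] := cbox_kap e n x; rewrite /theta /bump => th.
have [h3|h3] := ltP (pos e n x - (kap e n x)%:~R) (1 / 8).
  by exists (kap e n x); rewrite ger0_norm // subr_ge0.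
have [h4|h4] := ltP ((kap e n x)%:~R + 1 - pos e n x) (1 / 8).
  exists (kap e n x + 1); rewrite distrC intrD ger0_norm // subr_ge0 //.
case/eqP: th; apply: min_l; case: (leP (_ - _) _) => _; lra.
Qed.

(** Grids that differ by about half a box: a point cannot be within one eighth of
    a box of grid points of both. *)
Lemma theta_or t t' n x : (label t n).2 = false -> (label t' n).2 = true ->
  theta (shift t) n x = 1 \/ theta (shift t') n x = 1.
Proof.
move=> bt bt'; have [|/theta_near_int[j hj]] := eqVneq (theta (shift t) n x) 1; first by left.
have [|/theta_near_int[j' hj']] := eqVneq (theta (shift t') n x) 1; first by right.
have [i h1 h2] := shift_expansion t n; have [i' h3 h4] := shift_expansion t' n.
rewrite /shift_digit bt in h1 h2; rewrite /shift_digit bt' in h3 h4.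
rewrite /pos mulrBl !ltr_norml in hj hj'.
have /andP[h5 h6] := hj; have /andP[h7 h8] := hj'.
have p1 : 0 < j - j' - (i' - i) by rewrite -(ltr_int R) !intrB; lra.
have p2 : j - j' - (i' - i) < 1 by rewrite -(ltr_int R) !intrB; lra.
by move: (j - j' - (i' - i)) p1 p2 => k; rewrite ltNge -ltzD1 add0r => /negP.
Qed.

Definition bound t x : Prop := ~ free (shift t) (targets t) x.

(** Two prescriptions never meet: at some level where both indices aim at the
    values that they miss, one of the two grids has [x] far from its points. *)
Lemma bound_uniq t t' x : bound t x -> bound t' x -> t = t'.
Proof.
move=> bt bt'; apply: contrapT => tt'.
have miss u : bound u x -> exists s : rat, exists N, forall n, (N <= n)%N ->
    theta (shift u) n x = 1 -> targets u n <> ratr s.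
  move=> bu; apply: contrapT => h; apply: bu => s N; apply: contrapT => h'.
  apply: h; exists s, N => n Nn th E; apply: h'; by exists n.
have [s [N hN]] := miss t bt; have [s' [N' hN']] := miss t' bt'.
have [n] := label_pair (s, false) (s', true) (maxn N N') tt'.
rewrite geq_max => /andP[Nn N'n] [l l'].
have [th|th] : theta (shift t) n x = 1 \/ theta (shift t') n x = 1.
- by apply: theta_or; rewrite ?l ?l'.
- by apply: hN Nn th _; rewrite /targets l.
- by apply: hN' N'n th _; rewrite /targets l'.
Qed.

Local Notation bvt t := (bv (shift t) (targets t)).

(** Convergence excludes that the values 0 and 1 recur. *)
Lemma limit_bound t x y :
  (forall d, 0 < d -> exists M, forall n, (M <= n)%N -> `|bvt t n x - y| < d) ->
  bound t x /\ forall l, cluster_point (fun n => bvt t n x) l -> l = y.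
Proof.
move=> lim; split=> [fr|l cl].
  have [M hM] := lim (1 / 2) ltac:(lra).
  have [n Mn E] := free_value 0 M fr; have [n' Mn' E'] := free_value 1 M fr.
  have := hM n Mn; have := hM n' Mn'; rewrite E E' rmorph0 rmorph1 !ltr_norml.
  by move=> /andP[? ?] /andP[? ?]; lra.
apply/eqP; rewrite -subr_eq0 -normr_eq0; apply: contraT => nz.
have d0 : 0 < `|l - y| / 2 by rewrite divr_gt0 // lt_def nz /=.
have [M hM] := lim _ d0; have [n Mn h] := cl _ M d0.
have := hM n Mn; have := ler_distD (bvt t n x) l y; rewrite (distrC l (bvt t n x)).
by move=> ? ?; lra.
Qed.

(** Where no prescription applies, the weight 0 makes the choice of the index
    immaterial. *)
Definition tag x : nat -> bool := xget (fun=> false) [set t | bound t x].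
Definition weight x : R :=
  if `[< exists t, bound t x >]
  then xget 0 [set l | cluster_point (fun n => bvt (tag x) n x) l] else 0.

Lemma bound_tag t x : bound t x -> tag x = t.
Proof.
rewrite /tag => bt; case: xgetP => [u _ /= bu|/(_ t)/(_ bt)//].
exact: (bound_uniq bu bt).
Qed.

Lemma bound_weight t x : bound t x -> cluster_point (fun n => bvt t n x) (weight x).
Proof.
move=> bt; rewrite /weight (bound_tag bt); case: asboolP => [_|[]]; last by exists t.
have [l cl] := bv_cluster (shift t) (targets t) x.
by case: xgetP => [u _ //|/(_ l)/(_ cl)].
Qed.

Lemma sectionP t : {x : R | tag x = t /\ weight x = 1}.
Proof.
apply: cid; have [C [[_ [x Cx]] _ hC]] :=
  bv_perfect_levels (shift t) (targets_often t) 1 ltr01.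
have [bx cl] := limit_bound (hC x Cx); exists x; split; first exact: bound_tag.
by apply: cl; exact: bound_weight.
Qed.

Definition sec t : R := sval (sectionP t).
Lemma tag_sec t : tag (sec t) = t.
Proof. by have [] := svalP (sectionP t). Qed.
Lemma weight_sec t : weight (sec t) = 1.
Proof. by have [] := svalP (sectionP t). Qed.

Lemma sec_inj : injective sec.
Proof. by move=> t t' /(congr1 tag); rewrite !tag_sec. Qed.

(** The prescriptions of distinct indices concern disjoint sets of points, so that
    all of them can be met at once, each with its own scalar factor. *)
Definition member (a : (nat -> bool) -> R) : R -> R := fun x => a (tag x) * weight x.

Lemma member_sec a t : member a (sec t) = a t.
Proof. by rewrite /member tag_sec weight_sec mulr1. Qed.

Lemma member_ladder a t : a t != 0 ->
  ladder (shift t) (fun n x => a t * bvt t n x) (member a).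
Proof.
move=> at0; apply: base_ladder => // x bx.
rewrite /member (bound_tag bx) mulrAC mulfV // mul1r; exact: bound_weight.
Qed.

Lemma member_perfect_levels a t : a t != 0 -> perfect_levels (member a).
Proof.
move=> at0 y u v uv.
have [C [pC Cuv hC]] := bv_perfect_levels (shift t) (targets_often t) (y / a t) uv.
exists C; split=> // x /hC lim; have [bx cl] := limit_bound lim.
rewrite /member (bound_tag bx) (cl _ (bound_weight bx)) mulrC divfK //.
Qed.

(** * The closed subspace *)

Definition space : set (R -> R) := range member.

Lemma space_subspace : is_vector_subspace space.
Proof.
split; first by rewrite inE; exists (fun=> 0) => //; apply/funext => x; rewrite /member mul0r.
move=> c f g; rewrite !inE => -[a _ <-] [b _ <-].
exists (fun t => c * a t + b t) => //; apply/funext => x.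
by rewrite /member mulrDl -mulrA.
Qed.

(** The coefficient at an index is the value at one point, so that membership is
    a system of linear equations between values at points. *)
Lemma spaceE : space =
  \bigcap_x [set f : R -> R | f x - f (sec (tag x)) * weight x = 0].
Proof.
apply/seteqP; split=> [_ [a _ <-] x _ /=|f hf].
  by rewrite member_sec subrr.
exists (fun t => f (sec t)) => //; apply/funext => x.
by rewrite /member; apply/esym/eqP; rewrite -subr_eq0; apply/eqP; exact: hf.
Qed.

Lemma pair_continuous (S T U : topologicalType) (f : S -> T) (g : S -> U) :
  continuous f -> continuous g -> continuous (fun s => (f s, g s)).
Proof. by move=> cf cg s; apply: cvg_pair; [exact: cf|exact: cg]. Qed.

Lemma space_closed : closed (space : set {ptws R -> R}).
Proof.
rewrite spaceE; apply: closed_bigI => x _.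
set y := sec (tag x); set w := weight x.
pose px := @proj R (fun=> R) x; pose py := @proj R (fun=> R) y.
pose ev : {ptws R -> R} -> R * R := fun f => (px f, py f).
pose g (p : R * R) : R := p.1 - p.2 * w.
have cg : continuous g.
  move=> p; apply: cvgB; first exact: cvg_fst.
  by apply: cvgM; [exact: cvg_snd|exact: cvg_cst].
have cev : continuous ev.
  by apply: pair_continuous; exact: proj_continuous.
have -> : [set f : R -> R | f x - f y * w = 0] = ev @^-1` (g @^-1` [set 0]) by [].
apply: preimage_closed => [f _|]; first exact: cev.
by apply: preimage_closed => [p _|]; [exact: cg|exact: closed_eq].
Qed.

End Family.

Arguments space : clear implicits.

(** * Cardinals *)

Local Open Scope card_scope.

Lemma card_le_inj (T U : Type) (A : set T) (B : set U) (f : T -> U) :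
  (forall x, A x -> B (f x)) -> (forall x y, A x -> A y -> f x = f y -> x = y) ->
  A #<= B.
Proof.
move=> AB fI; have fI' : {in A &, injective f}.
  by move=> x y; rewrite !inE; exact: fI.
rewrite -(card_le_eql (inj_card_eq fI')); apply: subset_card_le.
by move=> _ [x /AB Bfx <-].
Qed.

Lemma card_le_surj (T U : Type) (A : set T) (B : set U) (f : T -> U) :
  B `<=` f @` A -> B #<= A.
Proof.
by move=> BA; apply: card_le_trans (subset_card_le BA) (card_image_le _ _).
Qed.

Lemma cantor_not_le (X : pointedType) : ~ ([set: set X] #<= [set: X]).
Proof.
move=> /pcard_leTP[f]; pose D : set X := [set x | exists2 A, f A = x & ~ A x].
have fI (A B : set X) : f A = f B -> A = B by apply: inj; rewrite inE.
have nD : ~ D (f D) by move=> /[dup] Dd [A /fI -> /(_ Dd)].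
by apply: (nD); exists D.
Qed.

Section WellOrder.
Variables (U : eqType) (r : rel U).
Hypothesis wo : wochoice.well_order r.
Implicit Types (u v w : U).

Lemma wo_min (P : set U) : P !=set0 -> exists2 u, P u & forall v, P v -> r u v.
Proof.
move=> [x Px]; have [|u [[Pu mu] _]] := wo (A := fun u => `[< P u >]).
  by exists x; apply/asboolP.
by exists u => [|v Pv]; [exact/asboolP|apply: mu; apply/asboolP].
Qed.

Lemma wo_total u v : r u v \/ r v u.
Proof.
have [|w [->|->] mw] := @wo_min [set x | x = u \/ x = v].
- by exists u; left.
- by left; apply: mw; right.
- by right; apply: mw; left.
Qed.

Lemma wo_anti u v : r u v -> r v u -> u = v.
Proof.
have refl x : r x x by case: (wo_total x x).
move=> uv vu; have [|z [_ uz]] := wo (A := [pred x | (x == u) || (x == v)]).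
  by exists u; rewrite inE eqxx.
have -> : u = z.
  apply/esym/uz; split; first by rewrite inE eqxx.
  by move=> x; rewrite inE => /orP[]/eqP->.
apply: uz; split; first by rewrite inE eqxx orbT.
by move=> x; rewrite inE => /orP[]/eqP->.
Qed.

Lemma wo_trans u v w : r u v -> r v w -> r u w.
Proof.
move=> uv vw; have [|z zE mz] := @wo_min [set x | [\/ x = u, x = v | x = w]].
  by exists u; constructor.
have zu : r z u by apply: mz; constructor.
have zv : r z v by apply: mz; constructor.
have zw : r z w by apply: mz; constructor.
case: zE zu zv zw => -> zu zv zw //; first by rewrite (wo_anti uv zu).
by rewrite -(wo_anti vw zv).
Qed.

(** The strict initial segment of [u]; totality makes the negated form equivalent to
    the usual one. *)
Definition below u : set U := [set v | ~ r u v].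

Lemma below_wf : well_founded (fun v u => below u v).
Proof.
move=> u; apply: contrapT => nu.
have [|z nz mz] := @wo_min [set x | ~ Acc (fun v u => below u v) x]; first by exists u.
apply: nz; constructor => y ly; apply: contrapT => /mz; exact: ly.
Qed.

Lemma below_sub u v : below u v -> below v `<=` below u.
Proof.
move=> uv w vw uw; have [//|wv] := wo_total v w; apply: uv.
exact: wo_trans uw wv.
Qed.

(** Match the elements of [K], in increasing order, with elements of [C] that
    are not used yet: either this never stops, or [C] is exhausted. *)
Lemma well_order_match (W : Type) (K : set U) (C : set W) :
  K #<= C \/ exists2 u, K u & C #<= below u.
Proof.
pose step u (rec : forall v, below u v -> option W) : option W :=
  match pselect (exists w : W, C w /\ forall v (l : below u v), rec v l <> Some w) with
  | left ex => Some (sval (cid ex))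
  | right _ => None
  end.
pose h := Fix below_wf (fun=> option W) step.
have hE u : h u = step u (fun v _ => h v).
  rewrite /h Fix_eq // => x f g fg.
  by have -> : f = g by apply: functional_extensionality_dep => y; apply/funext => l; exact: fg.
have [[u [Ku hu]]|all] := pselect (exists u, K u /\ h u = None).
  right; exists u => //; rewrite -card_ge_some.
  apply: (@card_le_surj _ _ _ _ h) => _ [w Cw <-].
  move: hu; rewrite hE /step; case: pselect => // nex _.
  apply: contrapT => no; apply: nex; exists w; split=> // v l E.
  by apply: no; exists v.
left; rewrite -card_le_some.
have hS u : K u -> exists2 w : W, h u = Some w &
    C w /\ forall v, below u v -> h v <> Some w.
  move=> Ku; have : h u <> None by move=> E; apply: all; exists u.
  rewrite hE /step; case: pselect => // ex _; exists (sval (cid ex)) => //.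
  exact: (svalP (cid ex)).
apply: (@card_le_inj _ _ _ _ h) => [u /hS[w -> [Cw _]]|u v Ku Kv E]; first by exists w.
have [w hu [_ nu]] := hS u Ku; have [w' hv [_ nv]] := hS v Kv.
have [ruv|nruv] := pselect (r u v); last first.
  by case: (nu v nruv); rewrite -E.
have [rvu|nrvu] := pselect (r v u); first exact: wo_anti.
by case: (nv u nrvu); rewrite E.
Qed.

End WellOrder.

(** The elements of a well-ordered power set whose initial segment is at most as
    large as [X] form a set of the size of the successor. The last clause is
    minimality in the form that presupposes no comparability with [X]. *)
Lemma card_succ_exists (X : pointedType) : exists (T : Type) (K : set T),
  is_card_succ [set: X] K /\
  forall (V : Type) (C : set V), ~ (C #<= [set: X]) -> K #<= C.
Proof.
have [r wo] := wochoice.well_ordering_principle (set X).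
pose K := [set u : set X | below r u #<= [set: X]].
have Kle (V : Type) (C : set V) : ~ (C #<= [set: X]) -> K #<= C.
  move=> nC; have [//|[u Ku Cu]] := well_order_match wo K C.
  by case: nC; exact: card_le_trans Cu Ku.
have nK : ~ (K #<= [set: X]).
  move=> KX; have [all|] := pselect (forall u, K u).
    apply: (@cantor_not_le X); apply: card_le_trans KX.
    by apply: subset_card_le => u _; exact: all.
  move=> /existsNP nex; have [|u nKu mu] := @wo_min _ r wo (~` K).
    by have [u nKu] := nex; exists u.
  apply: nKu; apply: card_le_trans KX; apply: subset_card_le => v.
  by move=> nuv; apply: contrapT => /mu.
exists (set X), K; split=> //; split; last by move=> V C [_ nC]; exact: Kle.
split=> //; have [KX|[u Ku Xu]] := well_order_match wo K [set: X]; first by case: nK.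
apply: card_le_trans Xu _; apply: subset_card_le => v /(below_sub wo) vu.
exact: card_le_trans (subset_card_le vu) Ku.
Qed.

(** * Hamel bases *)

Section Hamel.
Variables (R : realType) (E : lmodType R).
Implicit Types (V A B L : set E) (s : seq E) (c : E -> R) (u : E).

Lemma lin_indep_notin B u : lin_indep B -> ~ lin_span B u -> lin_indep (u |` B).
Proof.
move=> iB nu s c us sB sum0.
have [uin|uout] := boolP (u \in s); last first.
  apply: iB => // v vs; case: (sB v vs) => [E0|//].
  by rewrite -E0 vs in uout.
have B' v : v \in rem u s -> B v.
  rewrite mem_rem_uniq // inE => /andP[vu /sB[]// /eqP]; by rewrite (negbTE vu).
rewrite (big_rem u uin) /= in sum0.
have cu : c u = 0.
  apply/eqP/negP => /negP cu; apply: nu; exists (rem u s), (fun v => - (c v / c u)).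
  split=> //; transitivity ((c u)^-1 *: (c u *: u)); first by rewrite scalerA mulVf // scale1r.
  move/eqP: sum0; rewrite addr_eq0 => /eqP ->; rewrite scalerN scaler_sumr -sumrN.
  by apply: eq_bigr => v _; rewrite scaleNr scalerA mulrC.
rewrite cu scale0r add0r in sum0; move=> v vs.
have [->//|vu] := eqVneq v u.
apply: (iB (rem u s) c (rem_uniq u us) B' sum0).
by rewrite mem_rem_uniq // inE vu.
Qed.

Lemma span_sub V B : is_vector_subspace V -> B `<=` V -> lin_span B `<=` V.
Proof.
move=> [V0 VD] BV _ [s [c [sB ->]]]; rewrite inE in V0.
elim: s sB => [|v s IH] sB; first by rewrite big_nil.
rewrite big_cons -inE; apply: VD; rewrite inE.
  by apply: BV; apply: sB; rewrite inE eqxx.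
by apply: IH => w ws; apply: sB; rewrite inE ws orbT.
Qed.

(** Starting from a given independent family avoids counting the elements of an
    unknown basis: its size is squeezed between two sets of known size. *)
Lemma hamel_basis_extends V L : is_vector_subspace V -> lin_indep L -> L `<=` V ->
  exists2 B, is_hamel_basis V B & L `<=` B /\ B `<=` V.
Proof.
move=> sV iL LV.
have [|A [[iA AV] maxA]] := @Zorn_bigcup E [set A | lin_indep (L `|` A) /\ A `<=` V].
  move=> F FP tF; split; last by move=> v [A /FP[_]]; apply.
  move=> s c us sF; suff [A PA sA] : exists2 A, lin_indep (L `|` A) &
      forall v, v \in s -> (L `|` A) v by exact: PA.
  have [A FA sA] : exists2 A, A = set0 \/ F A & forall v, v \in s -> (L `|` A) v.
    elim: s sF {us} => [|v s IH] sF; first by exists set0; [left|].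
    have [|A FA sA] := IH; first by move=> w ws; apply: sF; rewrite inE ws orbT.
    have [Lv|[A' FA' A'v]] : (L `|` \bigcup_(X in F) X) v by apply: sF; rewrite inE eqxx.
      by exists A => // w; rewrite inE => /orP[/eqP->|/sA//]; left.
    have [AA'|A'A] : A `<=` A' \/ A' `<=` A.
      by case: FA => [->|FA]; [left|exact: tF].
      exists A'; first by right.
      move=> w; rewrite inE => /orP[/eqP->|/sA[?|/AA' ?]]; by [right|left|right].
    exists A => // w; rewrite inE => /orP[/eqP->|/sA//]; right; exact: A'A.
  exists A => //; case: FA => [->|/FP[]//]; by rewrite setU0.
exists (L `|` A); last by split=> [v|v [/LV|/AV]//]; left.
split=> //; apply/seteqP; split; first by apply: span_sub => // v [/LV|/AV].
move=> u Vu; apply: contrapT => nu; apply: (maxA (u |` A)).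
  split; first by move=> v; right.
  move=> /(_ u (or_introl erefl)) Au; apply: nu.
  exists [:: u], (fun=> 1); rewrite big_seq1 scale1r; split=> // v.
  by rewrite inE => /eqP ->; right.
split; last by move=> v [->|/AV].
by rewrite setUCA; exact: lin_indep_notin.
Qed.

End Hamel.

(** * The dimension of the subspace *)

Section Dimension.
Variable R : realType.
Local Notation T := (nat -> bool).
Implicit Types (x y : R) (t : T) (X : set T).

Definition encode (l : seq T) : T := fun n =>
  if (unpickle n : option (nat * nat)) is Some (i, j)
  then if j is j'.+1 then nth (fun=> false) l i j' else (i < size l)%N
  else false.

Lemma encode_inj : injective encode.
Proof.
move=> l l' E.
have E2 (i j : nat) : encode l (pickle (i, j)) = encode l' (pickle (i, j)) by rewrite E.
have sz : size l = size l'.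
  have h i : (i < size l)%N = (i < size l')%N by have := E2 i 0%N; rewrite /encode pickleK.
  by have := h (size l); have := h (size l'); rewrite !ltnn; case: ltngtP.
apply: (@eq_from_nth _ (fun=> false)) => // i _; apply/funext => j.
by have := E2 i j.+1; rewrite /encode pickleK.
Qed.

Definition decode t : seq T := xget [::] [set l | encode l = t].

Lemma encodeK : cancel encode decode.
Proof.
move=> l; rewrite /decode; case: xgetP => [l' _ /encode_inj //|/(_ l)/(_ erefl)//].
Qed.

(** The multiplicative extension of the indicator of [X] to the free monoid. *)
Definition all_in X (l : seq T) : R := \prod_(t <- l) (if `[< X t >] then 1 else 0).

(** The argument of Dedekind and Artin: multiplying the relation at [l] by a value
    at [t] and comparing with the relation at [t :: l] removes one character. *)
Lemma all_in_indep (I : eqType) (X : I -> set T) (s : seq I) (c : I -> R) :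
  uniq s -> {in s &, injective X} ->
  (forall l, \sum_(i <- s) c i * all_in (X i) l = 0) -> forall i, i \in s -> c i = 0.
Proof.
elim: s c => // i0 s IH c /= /andP[i0s us] Xinj sum0.
pose ch i t : R := if `[< X i t >] then 1 else 0.
have c0 i : i \in s -> c i = 0.
  move=> si; have [t Xt] : exists t, ch i t - ch i0 t != 0.
    apply: contrapT => /forallNP h; case/negP: i0s.
    suff <- : i = i0 by [].
    apply: Xinj; rewrite ?inE ?eqxx ?si ?orbT //.
    apply/funext => t; apply/propext; have /negP := h t; rewrite negbK subr_eq0 /ch.
    case: asboolP => h1; case: asboolP => h2 //; first by rewrite oner_eq0.
    by rewrite eq_sym oner_eq0.
  have us' : {in s &, injective X}.
    by move=> j k sj sk; apply: Xinj; rewrite inE ?sj ?sk orbT.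
  have := IH (fun j => c j * (ch j t - ch i0 t)) us us'.
  move=> /(_ _ i si) /eqP; rewrite mulf_eq0 (negbTE Xt) orbF => h; apply/eqP/h => l.
  have := sum0 (t :: l); have /(congr1 (fun z => ch i0 t * z)) := sum0 l.
  rewrite mulr0 !big_cons mulrDr => e1 e2.
  transitivity ((c i0 * all_in (X i0) (t :: l) + \sum_(j <- s) c j * all_in (X j) (t :: l)) -
     (ch i0 t * (c i0 * all_in (X i0) l) + ch i0 t * (\sum_(j <- s) c j * all_in (X j) l))).
    rewrite /all_in big_cons -/(ch i0 t) -/(all_in _ _) mulrCA opprD addrACA subrr add0r.
    rewrite mulr_sumr -sumrB; apply: eq_bigr => j _.
    by rewrite big_cons -/(ch j t); ring.
  by rewrite e1 e2 subrr.
move=> i; rewrite inE => /orP[/eqP->|]; last exact: c0.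
have := sum0 [::]; rewrite big_cons big_seq big1; last by move=> j sj; rewrite c0 // mul0r.
by rewrite addr0 /all_in big_nil mulr1.
Qed.

Definition indicator X : R -> R := member (fun t => all_in X (decode t)).

Lemma indicator_sec X l : indicator X (sec R (encode l)) = all_in X l.
Proof. by rewrite /indicator member_sec encodeK. Qed.

Lemma indicator_inj : injective indicator.
Proof.
move=> X Y E; apply/funext => t; apply/propext.
have := indicator_sec X [:: t]; rewrite E indicator_sec /all_in !big_seq1.
have : (1 : R) != 0 by exact: oner_neq0.
by case: asboolP => h1; case: asboolP => h2 // /eqP ne E1; case: ne; rewrite E1.
Qed.

Lemma indicator_indep : lin_indep (range indicator).
Proof.
move=> s c us sL sum0.
pose X (v : R -> R) := xget set0 [set Y | indicator Y = v].
have XE v : v \in s -> indicator (X v) = v.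
  move=> /sL[Y _ Yv]; rewrite /X; case: xgetP => [Z _ //|/(_ Y)/(_ Yv)//].
apply: (@all_in_indep _ X) => // [u v us' vs /(congr1 indicator)|l].
  by rewrite !XE.
have := congr1 (fun g : R -> R => g (sec R (encode l))) sum0.
rewrite fct_sumE => E; rewrite -[RHS]E !big_seq; apply: eq_bigr => v vs.
by rewrite -indicator_sec XE.
Qed.

(** The cut of [x] in the rational numbers. *)
Definition cut x : T := fun n =>
  if (unpickle n : option rat) is Some r then ratr r < x else false.

Lemma cut_inj : injective cut.
Proof.
have lt x y : x < y -> cut x <> cut y.
  move=> /rat_in_itvoo[r]; rewrite in_itv /= => /andP[xr ry].
  move=> /(congr1 (@^~ (pickle r))); rewrite /cut pickleK ry ltNge (ltW xr).
  by [].
by move=> x y E; case: (ltgtP x y) => // /lt; rewrite E.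
Qed.

Definition interleave (t u : T) : T := fun n => if odd n then t n./2 else u n./2.

Lemma interleave_inj t u t' u' : interleave t u = interleave t' u' -> t = t' /\ u = u'.
Proof.
move=> E; split; apply/funext => n.
  by have := congr1 (@^~ n.*2.+1) E; rewrite /interleave /= odd_double /= uphalf_double.
by have := congr1 (@^~ n.*2) E; rewrite /interleave odd_double doubleK.
Qed.

Definition real_pair x y : R := sec R (interleave (cut x) (cut y)).

Lemma real_pair_inj x y x' y' : real_pair x y = real_pair x' y' -> x = x' /\ y = y'.
Proof. by move=> /sec_inj/interleave_inj[/cut_inj -> /cut_inj ->]. Qed.

Lemma card_functions : [set: R -> R] #<= [set: set R].
Proof.
apply: (@card_le_inj _ _ _ _ (fun g => range (fun x => real_pair x (g x)))) => // g g' _ _ E.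
apply/funext => x; have : range (fun x => real_pair x (g x)) (real_pair x (g x)) by exists x.
by rewrite E => -[y _ /real_pair_inj[-> ->]].
Qed.

Lemma space_dim : has_dim (space R) [set: set R].
Proof.
have [|B hB [LB BV]] := hamel_basis_extends (space_subspace R) indicator_indep.
  by move=> _ [X _ <-]; exists (fun t => all_in X (decode t)).
exists B => //; rewrite card_eq_le; apply/andP; split.
  exact: card_le_trans (card_leT B) card_functions.
apply: (@card_le_inj _ _ _ _ (fun Y : set R => indicator (cut @` Y))) => [Y _|Y Y' _ _].
  by apply: LB; exists (cut @` Y).
have sub (Z Z' : set R) : cut @` Z = cut @` Z' -> Z `<=` Z'.
  move=> E x Zx; have : (cut @` Z) (cut x) by exists x.
  by rewrite E => -[y Zy /cut_inj <-].
by move=> /indicator_inj E; apply/seteqP; split; apply: sub.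
Qed.

Lemma space_in (M : set (R -> R)) :
  (forall a t, a t != 0 -> M (member a)) -> closed_subspace_in M (space R).
Proof.
move=> hM; split; [exact: space_subspace|exact: space_closed|].
move=> _ [a _ <-]; have [[t at0]|/forallNP all0] := pselect (exists t, a t != 0).
  by left; apply: hM at0.
right; apply/funext => x; rewrite /member.
by have /negP := all0 (tag x); rewrite negbK => /eqP ->; rewrite mul0r.
Qed.

Lemma spaceable (M : set (R -> R)) :
  (forall a t, a t != 0 -> M (member a)) -> spaceable_p M [set: set R].
Proof. by move=> hM; exists (space R); [exact: space_in|exact: space_dim]. Qed.

(** The upper bound is the size of the space of all functions. *)
Lemma Lp_succ (M : set (R -> R)) : (forall a t, a t != 0 -> M (member a)) ->
  exists (U : Type) (K : set U), is_card_succ [set: set R] K /\ is_Lp M K.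
Proof.
move=> hM; have [U [K [sK minK]]] := card_succ_exists (set R).
exists U, K; split=> //; split.
  move=> [V _ [B _ KB]]; case: sK => -[_ nK] _; apply: nK.
  by apply: card_le_trans KB _; apply: card_le_trans (card_leT B) card_functions.
move=> W L noV; apply: minK => LR; apply: noV; exists (space R); first exact: space_in.
have [B hB BR] := space_dim; exists B => //.
by move: BR; rewrite card_eq_le => /andP[_ RB]; exact: card_le_trans LR RB.
Qed.

End Dimension.

Theorem theorem3p1 (R : realType) :
  (exists (T : Type) (K : set T),
     is_card_succ [set: set R] K /\ is_Lp (Extendable R) K) /\
  (spaceable_p (Extendable R) [set: set R] /\
   spaceable_p (AlmostContinuous R) [set: set R] /\
   spaceable_p (Connectivity R) [set: set R] /\
   spaceable_p (Darboux R) [set: set R] /\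
   spaceable_p (SCIVP R) [set: set R] /\
   spaceable_p (CIVP R) [set: set R] /\
   spaceable_p (PR R) [set: set R] /\
   spaceable_p (WCIVP R) [set: set R] /\
   spaceable_p (PeripherallyContinuous R) [set: set R]).
Proof.
have ext (a : (nat -> bool) -> R) t : a t != 0 -> Extendable R (member a).
  by move=> at0; exact: (ladder_extendable (member_ladder at0)).
split; first exact: (Lp_succ ext).
refine (conj _ (conj _ (conj _ (conj _ (conj _ (conj _ (conj _ (conj _ _))))))));
  apply: spaceable => a t at0.
- exact: (ext a t at0).
- exact: (ladder_almost_continuous (member_ladder at0)).
- exact: (extendable_connectivity (ext a t at0)).
- exact: (connectivity_darboux (extendable_connectivity (ext a t at0))).
- exact: (perfect_levels_scivp (member_perfect_levels at0)).
- exact: (perfect_levels_civp (member_perfect_levels at0)).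
- exact: (perfect_levels_pr (member_perfect_levels at0)).
- exact: (perfect_levels_wcivp (member_perfect_levels at0)).
- exact: (perfect_levels_pc (member_perfect_levels at0)).
Qed.
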